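(* Let $R^-,R^+\in SO(2)$ and let $(A_\varepsilon,S_\varepsilon)\in\mathcal{C}_\varepsilon(Q_{1/2})$, $\varepsilon>0$, be such that $$A_\varepsilon\chi_{Q_{1/2}\setminus B_{\lambda\varepsilon}(S_\varepsilon)}\to I_{R^-,R^+}\ \text{in }L^1(Q_{1/2};\mathbb{R}^{2\times2})\quad\text{and}\quad\lim_{\varepsilon\to0^+}\frac1\varepsilon\mathcal{F}_\varepsilon(A_\varepsilon,S_\varepsilon;Q_{1/2})=\psi_0(R^-,R^+).$$ Then, for every $\delta\in(0,\frac14)$, $$\lim_{\varepsilon\to0}\frac1\varepsilon\mathcal{F}_\varepsilon(A_\varepsilon,S_\varepsilon;Q_{1/2}\setminus Q_{\delta,1/2})=0,$$ where $Q_{\delta,1/2}=(-\delta,\delta)\times(-\frac12,\frac12)$.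
   Context: Notation: $Q_r=(-r,r)\times(-r,r)$ and $I_{R^-,R^+}(x):=R^-\chi_{\{x_1<0\}}(x)+R^+\chi_{\{x_1\ge0\}}(x)$. Model. Fix parameters $\lambda,\tau>0$. For $\varepsilon>0$ and a bounded open set $\Omega\subset\mathbb{R}^2$, $\mathcal{C}_\varepsilon(\Omega)$ is the set of pairs $(A,S)$ with $A\in L^1(\Omega;\mathbb{R}^{2\times2})$ and $S\subset\Omega$ relatively closed such that: (a) $S\supseteq\mathrm{supp}(\mathrm{Curl}\,A)$, where $\mathrm{Curl}\,A$ is the row-wise distributional curl; (b) for every simple rectifiable closed curve $\gamma$ in $\Omega\setminus S$ one has $\int_\gamma A\in\tau\varepsilon\mathbb{Z}^2$. Here $\int_\gamma A:=-\mathrm{sgn}(\gamma)\int_\Omega A\,\nabla^\perp\varphi\,dx$, where $D\subset\Omega$ is the open set with $\gamma=\partial D$, $\mathrm{sgn}(\gamma)=+1$ if $\gamma$ is anticlockwise and $-1$ if clockwise, $\varphi\in C_c^\infty(\Omega)$ is any function with $\varphi=1$ on $D$ and $(\mathrm{supp}\,\varphi)\setminus D\subset\Omega\setminus S$, and $\nabla^\perp\varphi=(\partial_2\varphi,-\partial_1\varphi)$ (this does not depend on $\varphi$ and is the usual line integral for continuous $A$). Energy. For $(A,S)\in\mathcal{C}_\varepsilon(\Omega)$ and a (measurable) subset $\Omega'\subset\Omega$, $$\mathcal{F}_\varepsilon(A,S;\Omega'):=\int_{\Omega'\setminus B_{\lambda\varepsilon}(S)}\mathrm{dist}^2(A(x),SO(2))\,dx+|B_{\lambda\varepsilon}(S)\cap\Omega'|,$$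 where $B_{\lambda\varepsilon}(S):=\{x\in\Omega:\mathrm{dist}(x,S)<\lambda\varepsilon\}$ and $|\cdot|$ is Lebesgue measure (Euclidean/Frobenius norm on matrices). Here $\Omega=Q_{1/2}$. Optimal interfacial energy: $$\psi_0(R^-,R^+):=\inf\Big\{\liminf_{\varepsilon\to0}\tfrac1\varepsilon\mathcal{F}_\varepsilon(A_\varepsilon,S_\varepsilon;Q_{1/2}):(A_\varepsilon,S_\varepsilon)\in\mathcal{C}_\varepsilon(Q_{1/2}),\ A_\varepsilon\chi_{Q_{1/2}\setminus B_{\lambda\varepsilon}(S_\varepsilon)}\to I_{R^-,R^+}\text{ in }L^1(Q_{1/2})\Big\}.$$ *)

(* Defs.v *)
From HB Require Import structures.
From mathcomp Require Import all_boot all_order all_algebra.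
From mathcomp Require Import all_classical all_reals all_analysis.

Set Implicit Arguments.
Unset Strict Implicit.
Unset Printing Implicit Defensive.

Import Order.TTheory GRing.Theory Num.Theory.
Import numFieldNormedType.Exports.

Local Open Scope classical_set_scope.
Local Open Scope ring_scope.

Section plane.
Context {R : realType}.
Implicit Types (x y p : R * R) (U D S Omega : set (R * R)).
Implicit Types (phi : R * R -> R) (A : R * R -> 'M[R]_2) (gamma : R -> R * R).

(* Lebesgue measure on the Borel sets of the plane. Every L^1 class has a Borel
   representative, so fields are taken to be Borel measurable functions. *)
Definition leb2 := (@lebesgue_measure R \x @lebesgue_measure R)%E.

(* The library norm on R * R is the max norm (same topology); distances in the
   model are Euclidean. *)
Definition eucl_dist x y : R :=
  Num.sqrt ((x.1 - y.1) ^+ 2 + (x.2 - y.2) ^+ 2).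

(* dist (x, S), equal to +oo when S is empty *)
Definition dist_set x S : \bar R :=
  ereal_inf [set (eucl_dist x y)%:E | y in S].

Definition rect (a b : R) : set (R * R) :=
  [set x | - a < x.1 < a /\ - b < x.2 < b].

Definition Q (r : R) : set (R * R) := rect r r.

Definition frobenius (M : 'M[R]_2) : R :=
  Num.sqrt (\sum_i \sum_j M i j ^+ 2).

Definition SO2 : set 'M[R]_2 := [set M | M *m M^T = 1%:M /\ \det M = 1].

Definition dist_SO2 (M : 'M[R]_2) : R := inf [set frobenius (M - T) | T in SO2].

Definition basis_vec (i : 'I_2) : R * R := ((i == 0)%:R, (i == 1)%:R).

Definition partial (i : 'I_2) phi : R * R -> R := fun x => 'D_(basis_vec i) phi x.

Definition smooth phi : Prop :=
  forall s : seq 'I_2, let psi := foldr partial phi s in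
    continuous psi /\ forall i x, derivable psi x (basis_vec i).

Definition supp phi : set (R * R) := closure [set x | phi x != 0].

(* phi in C_c^oo(U), extended by zero to the whole plane *)
Definition test_fun U phi : Prop :=
  [/\ smooth phi, compact (supp phi) & supp phi `<=` U].

Definition grad_perp phi x : 'cV[R]_2 :=
  \col_(i < 2) (if i == 0 then partial 1 phi x else - partial 0 phi x).

Definition int_grad_perp Omega A phi : 'cV[R]_2 :=
  \col_(i < 2) \int[leb2]_(x in Omega) (A x *m grad_perp phi x) i 0.

Definition L1_field Omega A : Prop :=
  forall i j, leb2.-integrable Omega (EFin \o (fun x => A x i j)).

(* The row-wise distributional curl d_1 A_i2 - d_2 A_i1 tested against phi is
   int_grad_perp Omega A phi; its support is the complement in Omega of the
   union of all open sets on which it vanishes. *)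
Definition supp_Curl Omega A : set (R * R) :=
  Omega `\` [set x | exists U, [/\ open U, U `<=` Omega, U x &
    forall phi, test_fun U phi -> int_grad_perp Omega A phi = 0]].

Definition relatively_closed Omega S : Prop :=
  exists2 C : set (R * R), closed C & S = C `&` Omega.

Definition rectifiable gamma : Prop :=
  exists M : R, forall s : seq R, itv_partition 0 1 s ->
    let g := gamma \o nth 1 (0 :: s) in
    \sum_(0 <= n < size s) eucl_dist (g n.+1) (g n) <= M.

Definition simple_closed_curve gamma : Prop :=
  [/\ {within `[0, 1], continuous gamma}, gamma 0 = gamma 1 &
      {in `[0, 1[ &, injective gamma}].

Definition boundary D : set (R * R) := closure D `\` D°.

(* D is the region enclosed by gamma: each of its points is encircled exactly
   once in the positive sense, the angle around the point being lifted to a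
   continuous function theta. *)
Definition anticlockwise gamma D : Prop :=
  forall p, D p -> exists rho theta : R -> R,
    [/\ {within `[0, 1], continuous theta},
        {in `[0, 1], forall t, 0 < rho t /\
           gamma t = (p.1 + rho t * cos (theta t), p.2 + rho t * sin (theta t))}
      & theta 1 - theta 0 = 2 * pi].

Definition curve_sgn gamma D : R := if `[< anticlockwise gamma D >] then 1 else -1.

(* v is the value of the integral of A along gamma obtained from some
   admissible cutoff function phi. With grad_perp = (d_2, - d_1) the leading
   minus sign makes v the opposite of the usual line integral; this is harmless
   below, as the set of allowed values is symmetric. *)
Definition curve_integral Omega A S gamma (v : 'cV[R]_2) : Prop :=
  exists D phi,
    [/\ open D, D `<=` Omega & boundary D = gamma @` `[0, 1]] /\
    [/\ test_fun Omega phi, forall x, D x -> phi x = 1,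
        supp phi `\` D `<=` Omega `\` S &
        v = - (curve_sgn gamma D *: int_grad_perp Omega A phi)].

Definition admissible (tau eps : R) Omega A S : Prop :=
  [/\ L1_field Omega A,
      relatively_closed Omega S,
      supp_Curl Omega A `<=` S &
      forall gamma v, simple_closed_curve gamma -> rectifiable gamma ->
        gamma @` `[0, 1] `<=` Omega `\` S ->
        curve_integral Omega A S gamma v ->
        exists z : 'cV[int]_2, v = (tau * eps) *: map_mx intr z].

Definition nbhd_in Omega (r : R) S : set (R * R) :=
  [set x | Omega x /\ (dist_set x S < r%:E)%E].

Definition energy (lambda eps : R) Omega A S (Omega' : set (R * R)) : \bar R :=
  (\int[leb2]_(x in Omega' `\` nbhd_in Omega (lambda * eps) S)
      (dist_SO2 (A x) ^+ 2)%:E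
   + leb2 (nbhd_in Omega (lambda * eps) S `&` Omega'))%E.

Definition interface (Rm Rp : 'M[R]_2) : R * R -> 'M[R]_2 :=
  fun x => if x.1 < 0 then Rm else Rp.

(* Families indexed by eps > 0; the values at eps <= 0 are irrelevant. *)
Definition interface_family (lambda tau : R) (Rm Rp : 'M[R]_2)
    (A : R -> R * R -> 'M[R]_2) (S : R -> set (R * R)) : Prop :=
  (forall eps, 0 < eps -> admissible tau eps (Q 2^-1) (A eps) (S eps)) /\
  (\int[leb2]_(x in Q 2^-1)
     (frobenius (\1_(Q 2^-1 `\` nbhd_in (Q 2^-1) (lambda * eps) (S eps)) x
                   *: A eps x - interface Rm Rp x))%:E)%E
    @[eps --> 0^'+] --> 0%E.

Definition psi0 (lambda tau : R) (Rm Rp : 'M[R]_2) : \bar R :=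
  ereal_inf [set l | exists (A : R -> R * R -> 'M[R]_2) (S : R -> set (R * R)),
    interface_family lambda tau Rm Rp A S /\
    l = limf_einf (fun eps : R => (eps^-1)%:E *
          energy lambda eps (Q 2^-1) (A eps) (S eps) (Q 2^-1))%E 0^'+].

End plane.

(* Main.v *)
Require Import Defs.
From HB Require Import structures.
From mathcomp Require Import all_boot all_order all_algebra.
From mathcomp Require Import all_classical all_reals all_analysis.
From mathcomp Require Import measurable_realfun.
From mathcomp Require Import ring lra.
Import Order.TTheory GRing.Theory Num.Theory.
Import numFieldNormedType.Exports.
Local Open Scope classical_set_scope.
Local Open Scope ring_scope.

(** The energy is additive over disjoint sets, and the whole square carries
    asymptotically psi0 * eps. So it suffices to show that the strip alone
    already carries at least psi0 * eps, up to o(eps): nothing is then left for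
    the complement, provided that psi0 is finite.

    Lower bound in the strip. The strip contains N disjoint squares of side
    2 d = 1 / N, stacked along the interface. Blowing one of them up by the
    factor N gives an admissible pair for the parameter N eps on the unit
    square, with the same limit [interface Rm Rp], because the interface is
    invariant under dilations centred on it. The energy scales like an area and
    eps like a length, so each square carries at least 2 d psi0 eps and the N
    squares together carry psi0 eps ([square_liminf]).

    Two points need care.

    The first one is uniformity. The scaling ratio below depends on eps and the
    families are indexed by all eps > 0, so psi0 is used through
    [psi0_lower_bound]: if c < psi0, every admissible pair with eps small and
    field L^1-close to the interface has energy greater than c * eps. Otherwise
    a sequence of counterexamples, interspersed in the family of
    [interface_family_interface], would contradict the definition of psi0.

    The second one is the boundary of the small square. Restricting S to a
    square q forgets the part of the neighbourhood of S that comes from points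
    of S outside q, and on this part the field is not controlled at all. The
    remedy ([fill]) is to add to S the part of its neighbourhood that lies in a
    layer of width lam * eps along the boundary of q. This creates new
    neighbourhood, whose area is at most 16 times that of the old neighbourhood
    in a slightly wider band around the boundary of q ([leb2_fill]). The
    neighbourhood has total area O(eps); among M concentric squares with
    disjoint bands, one has a band meeting it in area O(eps) / M
    ([leb2_pigeonhole]), which is negligible for M large.

    Finiteness of psi0 ([psi0_fin]) comes from the competitor A = interface
    with S the vertical segment, whose neighbourhood has area at most
    2 lam eps. Its admissibility rests on integration by parts, the traces on
    the segment being those of a cutoff that vanishes there. *)

Set Implicit Arguments.
Unset Strict Implicit.
Unset Printing Implicit Defensive.

(** * Affine changes of variables in the plane *)

Section affine.
Context {R : realType}.
Notation leb1 := (@lebesgue_measure R).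
Notation mR := (measurableTypeR R).

Definition aff1 (a k : R) : mR -> mR := fun x : R => a + k * x.

Lemma measurable_aff1 (a k : R) : measurable_fun [set: mR] (aff1 a k).
Proof.
apply: (@continuous_measurable_fun R) => x.
apply: (@continuousD _ R^o R) => //; first exact: cst_continuous.
exact: mulrl_continuous.
Qed.

(** Both sides are measures of E, so it is enough to compare them on half-open
    intervals. *)
Lemma lebesgue_aff1 (a k : R) (k0 : 0 < k) (E : set mR) : measurable E ->
  leb1 E = (k%:E * leb1 (aff1 a k @^-1` E))%E.
Proof.
move=> mE.
pose mu_ : {measure set mR -> \bar R} :=
  mscale (NngNum (ltW k0)) (pushforward leb1 (aff1 a k)).
pose mu := mu_ (measurable_aff1 a k).
rewrite (@lebesgue_measure_unique R mu) => // _ [[u v]] _ <-.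
rewrite /mu/= /mscale/= /pushforward.
have -> : aff1 a k @^-1` `]u, v]%classic = `]((u - a) / k), ((v - a) / k)]%classic.
  apply/seteqP; split => x; rewrite /aff1/= !in_itv/= ltr_pdivrMr// ler_pdivlMr//;
  by rewrite ltrBlDl lerBrDl mulrC.
rewrite !lebesgue_measure_itv/= !lte_fin ltr_pM2r ?invr_gt0// ltrD2r.
case: ifP => _; last by rewrite mule0.
rewrite -!EFinB -EFinM; congr EFin; field; exact: lt0r_neq0.
Qed.

(** This holds also for infinite and undefined differences, so that the changes of
    variables below apply to every measurable function. *)
Lemma gt0_muleBr (k : R) (a b : \bar R) : 0 < k ->
  (k%:E * (a - b) = k%:E * a - k%:E * b)%E.
Proof.
move=> k0; have k0' : (0 < k%:E)%E by rewrite lte_fin.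
by case: a b => [r| |] [s| |]; rewrite ?gt0_muley ?gt0_muleNy//= -?EFinM -?EFinB ?mulrBr.
Qed.

Definition aff (c : R * R) (k : R) : mR * mR -> mR * mR :=
  fun x => (c.1 + k * x.1, c.2 + k * x.2).

Lemma measurable_aff c k : measurable_fun setT (aff c k).
Proof.
apply/measurable_fun_pairP; split.
  exact: (measurableT_comp (measurable_aff1 _ _)).
exact: (measurableT_comp (measurable_aff1 _ _)).
Qed.

Lemma leb2_aff c k (k0 : 0 < k) (E : set (mR * mR)) : measurable E ->
  leb2 E = ((k ^+ 2)%:E * leb2 (aff c k @^-1` E))%E.
Proof.
move=> mE.
pose mu_ : {measure set (mR * mR) -> \bar R} :=
  mscale (NngNum (sqr_ge0 k)) (pushforward leb2 (aff c k)).
pose mu := mu_ (measurable_aff c k).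
rewrite /leb2 (@product_measure_unique _ _ _ _ _ _ _ mu)// => A B mA mB.
rewrite /mu/= /mscale/= /pushforward.
have -> : aff c k @^-1` (A `*` B) = (aff1 c.1 k @^-1` A) `*` (aff1 c.2 k @^-1` B).
  by [].
have mA' : measurable (aff1 c.1 k @^-1` A).
  by rewrite -[X in measurable X]setTI; exact: measurable_aff1.
have mB' : measurable (aff1 c.2 k @^-1` B).
  by rewrite -[X in measurable X]setTI; exact: measurable_aff1.
rewrite /leb2 product_measure1E// (lebesgue_aff1 c.1 k0 mA) (lebesgue_aff1 c.2 k0 mB).
by rewrite muleACA -EFinM expr2.
Qed.

(** An open set is the union of the countably many boxes with rational centre
    and size that it contains. *)
Lemma open_measurable2 (U : set (R * R)) : open U -> (measurable (U : set (mR * mR))).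
Proof.
move=> oU.
pose D (p : rat * rat * rat) : set (mR * mR) := ball (ratr p.1.1 : R)
    (ratr p.2 : R) `*` ball (ratr p.1.2 : R) (ratr p.2 : R).
have -> : (U : set (mR * mR)) = \bigcup_p (if `[< D p `<=` U >] then D p else set0).
  apply/seteqP; split => x; last first.
    by case=> p _; case: ifP => // /asboolP; apply.
  move=> Ux.
  have /nbhs_ballP[e/= e0 xe] : nbhs x U by exact: open_nbhs_nbhs.
  have e20 : 0 < e / 2 by rewrite divr_gt0.
  have /rat_in_itvoo[r] := e20; rewrite in_itv/= => /andP[r0 re].
  have /rat_in_itvoo[a] : x.1 - ratr r < x.1 by rewrite ltrBlDr ltrDl.
  rewrite in_itv/= => /andP[a1 a2].
  have /rat_in_itvoo[b] : x.2 - ratr r < x.2 by rewrite ltrBlDr ltrDl.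
  rewrite in_itv/= => /andP[b1 b2].
  exists (a, b, r) => //; rewrite ifT; last first.
    apply/asboolP => y []; rewrite /= -!ball_normE /ball_/= => y1 y2; apply: xe.
    move: y1 y2; rewrite !ltr_norml => /andP[y11 y12] /andP[y21 y22].
    by split; rewrite -ball_normE /ball_/= ltr_norml; apply/andP; split; lra.
  by split; rewrite /= -ball_normE /ball_/= ltr_norml; apply/andP; split; lra.
apply: countable_bigcupT_measurable => [|p]; first exact: countableP.
case: ifP => // _.
by apply: measurableX; apply: open_measurable; exact: ball_open.
Qed.

Lemma continuous_measurable2 (f : R * R -> R) : continuous f ->
  measurable_fun (setT : set (mR * mR)) (f : mR * mR -> mR).
Proof.
move=> /continuousP cf; apply: (measurability _ (RGenOpens.measurableE R)).
move=> _ [_ [a [b ->] <-]]; rewrite setTI; apply: open_measurable2.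
exact/cf/interval_open.
Qed.

Lemma ge0_integral_aff c k (k0 : 0 < k) (D : set (mR * mR)) (f : R * R -> \bar R) :
  measurable D -> measurable_fun D (f : mR * mR -> _) ->
  (forall y, D y -> (0 <= f y)%E) ->
  (\int[leb2]_(y in D) f y = (k ^+ 2)%:E * \int[leb2]_(x in aff c k @^-1` D) f (aff c k
      x))%E.
Proof.
move=> mD mf f0.
pose mu_ : {measure set (mR * mR) -> \bar R} := pushforward leb2 (aff c k).
pose mu := mu_ (measurable_aff c k).
pose nu := mscale (NngNum (sqr_ge0 k)) mu.
have E : forall A, measurable A -> A `<=` D -> leb2 A = nu A.
  by move=> A mA _; rewrite (leb2_aff c k0 mA).
have -> : (\int[leb2]_(y in D) f y = \int[nu]_(y in D) f y)%E.
  exact: eq_measure_integral.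
have pf : (\int[mu]_(y in D) f y = \int[leb2]_(x in aff c k @^-1` D) f (aff c k x))%E.
  apply: (ge0_integral_pushforward (measurable_aff c k) leb2 mD mf).
  by move=> y; rewrite inE; exact: f0.
have ms := @ge0_integral_mscale _ _ _ mu D mD (NngNum (sqr_ge0 k)) f mf f0.
by rewrite -pf; exact: ms.
Qed.

Lemma measurable_preimage_aff c k (D : set (mR * mR)) : measurable D ->
  measurable (aff c k @^-1` D).
Proof. by move=> mD; rewrite -[X in measurable X]setTI; exact: measurable_aff. Qed.

Lemma measurable_fun_aff d (T : measurableType d) c k (D : set (mR * mR)) (f : R * R ->
    T) :
  measurable D -> measurable_fun D (f : mR * mR -> _) ->
  measurable_fun (aff c k @^-1` D) (f \o aff c k : mR * mR -> _).
Proof.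
move=> mD mf _ Y mY; rewrite comp_preimage -preimage_setI.
by apply: measurable_preimage_aff; exact: mf.
Qed.

Lemma integrable_aff c k (k0 : 0 < k) (D : set (mR * mR)) (f : R * R -> \bar R) :
  measurable D -> leb2.-integrable D (f : mR * mR -> _) ->
  leb2.-integrable (aff c k @^-1` D) (f \o aff c k).
Proof.
move=> mD /integrableP[mf fi]; apply/integrableP; split.
  exact: measurable_fun_aff.
move: fi; rewrite (ge0_integral_aff c k0)//; last exact: measurableT_comp.
rewrite /comp; move: (integral _ _ _) => [r _| |]; rewrite ?ltry//.
by rewrite gt0_muley// lte_fin exprn_gt0.
Qed.

Lemma integral_aff c k (k0 : 0 < k) (D : set (mR * mR)) (f : R * R -> \bar R) :
  measurable D -> measurable_fun D (f : mR * mR -> _) ->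
  (\int[leb2]_(y in D) f y = (k ^+ 2)%:E * \int[leb2]_(x in aff c k @^-1` D) f (aff c k
      x))%E.
Proof.
move=> mD mf; rewrite [LHS]integralE [in RHS]integralE.
have -> := ge0_integral_aff c k0 mD (measurable_funepos mf) (fun y _ => funepos_ge0 f y).
have -> := ge0_integral_aff c k0 mD (measurable_funeneg mf) (fun y _ => funeneg_ge0 f y).
rewrite -gt0_muleBr ?exprn_gt0//; congr (_ * (_ - _))%E.
  exact: (congr1 (integral _ _) (esym (funepos_comp f (aff c k)))).
exact: (congr1 (integral _ _) (esym (funeneg_comp f (aff c k)))).
Qed.

End affine.

(** * Distance to the rotations *)

Section distance.
Context {R : realType}.
Notation mR := (measurableTypeR R).

Lemma frobeniusE (M : 'M[R]_2) :
  frobenius M = Num.sqrt (M 0 0 ^+ 2 + M 0 1 ^+ 2 + (M 1 0 ^+ 2 + M 1 1 ^+ 2)).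
Proof.
rewrite /frobenius !big_ord_recl !big_ord0 !addr0.
by have -> : lift ord0 ord0 = 1 :> 'I_2 by apply: val_inj.
Qed.

Lemma ord2 (i : 'I_2) : i = 0 \/ i = 1.
Proof. by case: i => [[|[|//]] i2]; [left|right]; exact: val_inj. Qed.

Lemma det2 (M : 'M[R]_2) : \det M = M 0 0 * M 1 1 - M 0 1 * M 1 0.
Proof.
rewrite (expand_det_row _ 0) !big_ord_recl big_ord0 addr0 /cofactor !det_mx11 !mxE/=.
have -> : lift ord0 ord0 = 1 :> 'I_2 by apply: val_inj.
have -> : lift 1 0 = 0 :> 'I_2 by apply: val_inj.
by rewrite /= expr0 expr1; ring.
Qed.

Lemma SO2_entries (T : 'M[R]_2) : SO2 T ->
  [/\ T 1 1 = T 0 0, T 1 0 = - T 0 1 & T 0 0 ^+ 2 + T 0 1 ^+ 2 = 1].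
Proof.
case=> TT; rewrite det2 => dT.
have e (i j : 'I_2) : T i 0 * T j 0 + T i 1 * T j 1 = (i == j)%:R.
  have := congr1 (fun M : 'M[R]_2 => M i j) TT.
  rewrite !mxE !big_ord_recl !big_ord0 !addr0 !mxE.
  by have -> : lift ord0 ord0 = 1 :> 'I_2 by apply: val_inj.
have := e 0 0; have := e 1 1; have := e 0 1; rewrite /= !mulr1n !mulr0n => e1 e2 e3.
split; rewrite ?expr2//.
  transitivity (T 1 1 * (T 0 0 * T 0 0 + T 0 1 * T 0 1)); first by rewrite e3 mulr1.
  transitivity (T 0 0 * (T 0 0 * T 1 1 - T 0 1 * T 1 0) + T 0 1 * (T 0 0 * T 1 0 +
      T 0 1 * T 1 1)); first ring.
  by rewrite dT e1; ring.
transitivity (T 1 0 * (T 0 0 * T 1 1 - T 0 1 * T 1 0)); first by rewrite dT mulr1.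
transitivity (T 1 1 * (T 0 0 * T 1 0 + T 0 1 * T 1 1) - T 0 1 * (T 1 0 * T 1 0 +
    T 1 1 * T 1 1)); first ring.
by rewrite e1 e2; ring.
Qed.

Definition rotation (c s : R) : 'M[R]_2 :=
  \matrix_(i, j) if i == j then c else if i == 0 then - s else s.

Lemma SO2_rotation c s : c ^+ 2 + s ^+ 2 = 1 -> SO2 (rotation c s).
Proof.
move=> cs; split; last by rewrite det2 !mxE/=; lra.
apply/matrixP => i j; rewrite !mxE !big_ord_recl !big_ord0 addr0 !mxE/=.
have -> : lift ord0 ord0 = 1 :> 'I_2 by apply: val_inj.
by case: (ord2 i) => ->; case: (ord2 j) => -> /=; rewrite ?mulr1n ?mulr0n; lra.
Qed.

(** With u = M00 + M11 and v = M10 - M01, the squared distance of M to the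
    rotation of angle t is |M|^2 + 2 - 2 (u cos t + v sin t), and the
    last bracket has maximum sqrt (u^2 + v^2). The closed form gives the measurability
    of the energy density. *)
Lemma dist_SO2E (M : 'M[R]_2) : dist_SO2 M =
  Num.sqrt (M 0 0 ^+ 2 + M 0 1 ^+ 2 + (M 1 0 ^+ 2 + M 1 1 ^+ 2) + 2
    - 2 * Num.sqrt ((M 0 0 + M 1 1) ^+ 2 + (M 1 0 - M 0 1) ^+ 2)).
Proof.
set u := M 0 0 + M 1 1; set v := M 1 0 - M 0 1; set h := Num.sqrt (u ^+ 2 + v ^+ 2).
have uv0 : 0 <= u ^+ 2 + v ^+ 2 by rewrite addr_ge0 ?sqr_ge0.
have h2 : h ^+ 2 = u ^+ 2 + v ^+ 2 by rewrite sqr_sqrtr.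
have h0 : 0 <= h by exact: sqrtr_ge0.
set m := Num.sqrt _; set E := [set frobenius (M - T) | T in SO2].
(* attained at (p, s) = (u, v) / h, and at any rotation if h = 0 *)
have Em : E m.
  have [p [s [ps puv]]] : exists p s, p ^+ 2 + s ^+ 2 = 1 /\ p * u + s * v = h.
    have [h00|h_neq0] := eqVneq h 0.
      exists 1, 0; split; first by lra.
      by move: h2; rewrite h00 => /esym/eqP; rewrite expr0n/= paddr_eq0 ?sqr_ge0//
          sqrf_eq0 => /andP[/eqP -> _]; lra.
    exists (u / h), (v / h); split.
      by rewrite !expr_div_n -mulrDl -h2 divff// expf_neq0.
    apply: (mulIf h_neq0); rewrite -expr2 h2; field; exact: h_neq0.
  exists (rotation p s); first exact: SO2_rotation.
  rewrite frobeniusE /m; congr Num.sqrt; rewrite !mxE/= -puv /u /v.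
  by lra.
have lbm : lbound E m.
  move=> _ [T /SO2_entries[T11 T10 T1] <-]; rewrite frobeniusE /m ler_wsqrtr// !mxE T11
      T10.
  set p := T 0 0 in T1 *; set s := T 0 1 in T1 *.
  have : p * u - s * v <= h.
    apply: (le_trans (ler_norm _)); rewrite -sqrtr_sqr ler_wsqrtr//.
    have -> : u ^+ 2 + v ^+ 2 = (p ^+ 2 + s ^+ 2) * (u ^+ 2 + v ^+ 2) by rewrite T1 mul1r.
    have := sqr_ge0 (p * v + s * u); nra.
  by rewrite /u /v => ?; nra.
apply/eqP; rewrite eq_le; apply/andP; split.
  by apply: ge_inf => //; exists m.
by apply: lb_le_inf => //; exists m.
Qed.

Lemma dist_SO2_SO2 (M : 'M[R]_2) : SO2 M -> dist_SO2 M = 0.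
Proof.
move=> /SO2_entries[T11 T10 T1]; rewrite dist_SO2E T11 T10.
apply/eqP; rewrite sqrtr_eq0.
have -> : (M 0 0 + M 0 0) ^+ 2 + (- M 0 1 - M 0 1) ^+ 2 = 2 ^+ 2.
  by lra.
rewrite sqrtr_sqr ger0_norm//; lra.
Qed.

Lemma measurable_dist_SO2 (D : set (mR * mR)) (A : R * R -> 'M[R]_2) :
  (forall i j, measurable_fun D (fun x : mR * mR => A x i j)) ->
  measurable_fun D (fun x : mR * mR => dist_SO2 (A x)).
Proof.
move=> mA; rewrite (_ : (fun x : mR * mR => _) = (fun x => Num.sqrt (A x 0 0 ^+ 2 +
    A x 0 1 ^+ 2 + (A x 1 0 ^+ 2 + A x 1 1 ^+ 2) + 2
    - 2 * Num.sqrt ((A x 0 0 + A x 1 1) ^+ 2 + (A x 1 0 - A x 0 1) ^+ 2)))); last first.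
  by apply/funext => x; exact: dist_SO2E.
apply: measurableT_comp; first exact: (continuous_measurable_fun (@sqrt_continuous R)).
apply: measurable_funB.
  apply: measurable_funD => //; apply: measurable_funD; apply: measurable_funD;
      exact: measurable_funX.
apply: measurable_funM => //.
apply: measurableT_comp; first exact: (continuous_measurable_fun (@sqrt_continuous R)).
apply: measurable_funD; apply: measurable_funX; first exact: measurable_funD.
exact: measurable_funB.
Qed.

Lemma measurable_frobenius (D : set (mR * mR)) (A : R * R -> 'M[R]_2) :
  (forall i j, measurable_fun D (fun x : mR * mR => A x i j)) ->
  measurable_fun D (fun x : mR * mR => frobenius (A x)).
Proof.
move=> mA; rewrite (_ : (fun x : mR * mR => _) = (fun x => Num.sqrt (A x 0 0 ^+ 2 +
    A x 0 1 ^+ 2 + (A x 1 0 ^+ 2 + A x 1 1 ^+ 2)))); last first.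
  by apply/funext => x; exact: frobeniusE.
apply: measurableT_comp; first exact: (continuous_measurable_fun (@sqrt_continuous R)).
apply: measurable_funD; apply: measurable_funD; exact: measurable_funX.
Qed.

End distance.

(** * Neighbourhoods and additivity of the energy *)

Section energy.
Context {R : realType}.
Notation mR := (measurableTypeR R).
Implicit Types (Om S E : set (R * R)) (x y c : R * R).

Definition square c (r : R) : set (R * R) :=
  [set x | c.1 - r < x.1 < c.1 + r /\ c.2 - r < x.2 < c.2 + r].

Lemma Q_square (r : R) : Q r = square 0 r.
Proof. by rewrite /Q /rect /square/= !add0r. Qed.

Lemma continuous_eucl_dist y : continuous (fun x => eucl_dist x y).
Proof.
have c1 (f : R * R -> R) : continuous f -> continuous (fun x => f x ^+ 2).
  move=> cf x.
  exact: (@continuous_comp _ _ _ f (fun z : R => z ^+ 2) x (cf x)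
      (@exprn_continuous R 2 _)).
have c2 : continuous (fun x : R * R => (x.1 - y.1) ^+ 2 + (x.2 - y.2) ^+ 2).
  move=> x; apply: (@cvgD _ R^o).
    apply: (c1 (fun z => z.1 - y.1)) => {}x.
    by apply: (@cvgB _ R^o); [exact: cvg_fst|exact: cvg_cst].
  apply: (c1 (fun z => z.2 - y.2)) => {}x.
  by apply: (@cvgB _ R^o); [exact: cvg_snd|exact: cvg_cst].
move=> x; exact: (@continuous_comp _ _ _ _ _ x (c2 x) (@sqrt_continuous R _)).
Qed.

Lemma eucl_distC x y : eucl_dist x y = eucl_dist y x.
Proof. by rewrite /eucl_dist -sqrrN opprB -[X in _ + X]sqrrN opprB. Qed.

Lemma eucl_dist_fst x y : `|x.1 - y.1| <= eucl_dist x y.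
Proof. by rewrite -sqrtr_sqr ler_wsqrtr// lerDl sqr_ge0. Qed.

Lemma eucl_dist_snd x y : `|x.2 - y.2| <= eucl_dist x y.
Proof. by rewrite -sqrtr_sqr ler_wsqrtr// lerDr sqr_ge0. Qed.

Lemma eucl_dist_aff c k x y : 0 < k -> eucl_dist (aff c k x)
    (aff c k y) = k * eucl_dist x y.
Proof.
move=> k0; rewrite /eucl_dist/= -[k in RHS]gtr0_norm// -sqrtr_sqr -sqrtrM ?sqr_ge0//.
by congr Num.sqrt; ring.
Qed.

Lemma nbhd_inE Om r S x : nbhd_in Om r S x <-> Om x /\ exists2 y, S y & eucl_dist x y < r.
Proof.
split=> -[Ox]; rewrite /dist_set.
  by move=> /ereal_inf_lt[_ [y Sy <-]]; rewrite lte_fin => yr; split => //; exists y.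
move=> [y Sy yr]; split=> //; rewrite (@le_lt_trans _ _ (eucl_dist x y)%:E)//.
by apply: ereal_inf_lbound; exists y.
Qed.

Lemma open_square c r : open (square c r).
Proof.
rewrite (_ : square c r = (fst @^-1` `]c.1 - r, c.1 +
    r[%classic) `&` (snd @^-1` `]c.2 - r, c.2 + r[%classic)).
  by apply: openI; [apply: (@open_comp _ _ fst) => [x _|];
      [exact: cvg_fst|exact: interval_open]
    |apply: (@open_comp _ _ snd) => [x _|]; [exact: cvg_snd|exact: interval_open]].
by apply/seteqP; split => x /=; rewrite !in_itv.
Qed.

Lemma open_nbhd_in Om r S : open Om -> open (nbhd_in Om r S).
Proof.
move=> oOm; rewrite (_ : nbhd_in Om r S = Om `&` \bigcup_(y in S) ((fun x =>
    eucl_dist x y) @^-1` [set t | t < r])).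
  apply: openI => //; apply: bigcup_open => y _.
  by apply: open_comp => [x _|]; [exact: continuous_eucl_dist|exact: open_lt].
apply/seteqP; split => x.
  by move=> /nbhd_inE[Ox [y Sy yr]]; split => //; exists y.
by move=> [Ox [y Sy yr]]; apply/nbhd_inE; split => //; exists y.
Qed.

Lemma measurable_square c r : measurable (square c r : set (mR * mR)).
Proof. by apply: open_measurable2; exact: open_square. Qed.

Section additivity.
Variables (lam eps : R) (Om S : set (R * R)) (A : R * R -> 'M[R]_2).
Hypotheses (oOm : open Om) (LA : L1_field Om A).
Local Notation B := (nbhd_in Om (lam * eps) S).

Lemma measurable_L1_field (i j : 'I_2) : measurable_fun (Om : set (mR * mR))
    (fun x : mR * mR => A x i j).
Proof. by have /integrableP[/measurable_EFinP] := LA i j. Qed.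

Lemma measurable_nbhd_in : measurable (B : set (mR * mR)).
Proof. by apply: open_measurable2; exact: open_nbhd_in. Qed.

Lemma measurable_energy_density E : E `<=` Om -> measurable (E : set (mR * mR)) ->
  measurable_fun (E : set (mR * mR)) (fun x : mR * mR => (dist_SO2 (A x) ^+ 2)%:E).
Proof.
move=> EO mE; apply/measurable_EFinP; apply: measurable_funX;
    apply: measurable_dist_SO2 => i j.
apply: measurable_funS (measurable_L1_field i j) => //; exact: open_measurable2.
Qed.

Lemma energy_ge0 E : (0 <= energy lam eps Om A S E)%E.
Proof.
by apply: adde_ge0 => //; apply: integral_ge0 => x _; rewrite lee_fin sqr_ge0.
Qed.

Lemma energyU E F : E `<=` Om -> F `<=` Om ->
  measurable (E : set (mR * mR)) -> measurable (F : set (mR * mR)) -> E `&` F = set0 ->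
  (energy lam eps Om A S (E `|` F) = energy lam eps Om A S E + energy lam eps Om A S F)%E.
Proof.
move=> EO FO mE mF EF; rewrite /energy.
have mB := measurable_nbhd_in.
have mEB := measurableD mE mB; have mFB := measurableD mF mB.
rewrite setDUl ge0_integral_setU//; last 3 first.
- apply: measurable_energy_density; last exact: measurableU.
  by rewrite -setDUl => x [[/EO|/FO]].
- by move=> x _; rewrite lee_fin sqr_ge0.
- by apply/disj_setPS => x [[Ex _] [Fx _]]; rewrite -EF.
rewrite setIUr.
have -> : (leb2 ((B `&` E) `|` (B `&` F)) = leb2 (B `&` E) + leb2 (B `&` F))%E.
  apply: (measureU (leb2 : {measure set (mR * mR) -> \bar R})); try exact: measurableI.
  by rewrite setIACA EF setI0.
by rewrite addeACA.
Qed.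

Lemma energyS E F : E `<=` F -> F `<=` Om ->
  measurable (E : set (mR * mR)) -> measurable (F : set (mR * mR)) ->
  (energy lam eps Om A S E <= energy lam eps Om A S F)%E.
Proof.
move=> EF FO mE mF; rewrite -(setDUK EF) energyU//.
- by rewrite leeDl// energy_ge0.
- exact: subset_trans FO.
- by move=> x [/FO].
- exact: measurableD.
- by apply/seteqP; split=> // x [? []].
Qed.

End additivity.
End energy.

(** * Test functions under dilations, and restriction to a subdomain *)

Section testfun.
Context {R : realType}.
Notation mR := (measurableTypeR R).
Implicit Types (Om U S E : set (R * R)) (x y c : R * R) (phi : R * R -> R).

(** The inverse of [aff c k], written as an affine map so that every statement
    about [aff] applies to it. *)
Definition affV c (k : R) := aff (- (k^-1 * c.1), - (k^-1 * c.2)) k^-1.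

Lemma affK c k : k != 0 -> cancel (aff c k) (affV c k).
Proof. by move=> k0 [x1 x2]; rewrite /affV /aff/=; congr pair; field. Qed.

Lemma affVK c k : k != 0 -> cancel (affV c k) (aff c k).
Proof. by move=> k0 [x1 x2]; rewrite /affV /aff/=; congr pair; field. Qed.

Lemma continuous_aff c k : continuous (aff c k : R * R -> R * R).
Proof.
rewrite (_ : (aff c k : R * R -> R * R) = fun x => c + k *: x).
  by move=> x; apply: cvgD; [exact: cvg_cst|apply: cvgZr; exact: cvg_id].
by apply/funext => x; rewrite /aff.
Qed.

(** One inclusion is continuity of the map, the other continuity of its inverse. *)
Lemma closure_preimage_aff c k (k0 : k != 0) E :
  closure (aff c k @^-1` E : set (R * R)) = aff c k @^-1` closure E.
Proof.
have sub c' k' E' : closure (aff c' k' @^-1` E' : set (R * R)) `<=` aff c' k' @^-1`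
    closure E'.
  move=> x xE V /(@continuous_aff c' k' x V) /xE[y []]; by exists (aff c' k' y).
apply/seteqP; split; first exact: sub.
move=> x xE; rewrite -(affK c k0 x).
apply: sub; rewrite /preimage/=; move: xE.
by rewrite /preimage/=; apply: closure_subset => y Ey; rewrite /= affVK.
Qed.

Lemma interior_preimage_aff c k (k0 : k != 0) E :
  interior (aff c k @^-1` E : set (R * R)) = aff c k @^-1` (interior E).
Proof.
by rewrite -[LHS]setCK -closure_setC preimage_setC closure_preimage_aff// closure_setC
    -preimage_setC setCK.
Qed.

(** The difference quotient of the composite at h is k times that of phi at
    k * h. *)
Lemma derive_aff c k (k0 : k != 0) phi y v : derivable phi (aff c k y) v ->
  derivable (phi \o aff c k : R * R -> R) y v /\
  'D_v (phi \o aff c k : R * R -> R) y = k * 'D_v phi (aff c k y).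
Proof.
move=> /cvg_ex[l hl].
have kh : (fun h : R => k * h) h @[h --> 0^'] --> (0 : R)^'.
  rewrite -[X in _ --> X^'](mulr0 k); apply: continuous_injective_withinNx.
    exact: mulrl_continuous.
  by move=> h; rewrite mulr0 => /eqP; rewrite mulf_eq0 (negbTE k0) => /eqP.
have H : h^-1 *: ((phi \o aff c k \o shift y) (h *: v) - (phi \o aff c k) y) @[h -->
    0^'] --> k * l.
  rewrite (_ : (fun h => _) = fun h => k * ((k * h)^-1 *: ((phi \o shift (aff c k y))
      ((k * h) *: v) - phi (aff c k y)))).
    apply: cvgMr; exact: (cvg_comp _ _ kh hl).
  apply/funext => h /=; rewrite /GRing.scale/= mulrA invfM mulrA divff// mul1r.
  congr (_ * (phi _ - _)); rewrite /aff/shift/=.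
  rewrite -[RHS]/(k * h * v.1 + (c.1 + k * y.1), k * h * v.2 + (c.2 + k * y.2)).
  rewrite -[LHS]/(c.1 + k * (h * v.1 + y.1), c.2 + k * (h * v.2 + y.2)).
  congr pair; ring.
split; first by apply/cvg_ex; exists (k * l).
by rewrite /derive (cvg_lim _ H)// (cvg_lim _ hl).
Qed.

Lemma partial_aff c k (k0 : k != 0) phi i : (forall x, derivable phi x (basis_vec i)) ->
  partial i (phi \o aff c k) = (fun y => k * partial i phi (aff c k y)).
Proof. by move=> d; apply/funext => y; rewrite /partial (derive_aff k0 (d _)).2. Qed.

(** Iterated partial derivatives of the composite are those of phi composed with
    the map, up to a power of k. *)
Lemma smooth_aff c k (k0 : k != 0) phi : smooth phi -> smooth (phi \o aff c k).
Proof.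
move=> sm s.
have -> : foldr partial (phi \o aff c k) s =
    (k ^+ size s) \*: (foldr partial phi s \o aff c k).
  elim: s => [|i s IH] /=; first by apply/funext => x; rewrite /= scale1r.
  have d := (sm s).2 i.
  rewrite IH; apply/funext => x; rewrite /partial deriveZ;
      last exact: (derive_aff k0 (d _)).1.
  by rewrite (derive_aff k0 (d _)).2 /= scalerA exprSr.
split=> [x|i x].
  apply: cvgZr.
  exact: (@continuous_comp _ _ _ (aff c k : R * R -> R * R) _ x (@continuous_aff c k x)
      ((sm s).1 _)).
apply: derivableZ; exact: (derive_aff k0 ((sm s).2 i _)).1.
Qed.

Lemma supp_aff c k (k0 : k != 0) phi : supp (phi \o aff c k) = aff c k @^-1` supp phi.
Proof. exact: closure_preimage_aff. Qed.

Lemma test_fun_aff c k (k0 : k != 0) U phi : test_fun U phi ->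
  test_fun (aff c k @^-1` U) (phi \o aff c k).
Proof.
move=> [sm cs sU]; split; first exact: smooth_aff.
  rewrite supp_aff// (_ : aff c k @^-1` supp phi = affV c k @` supp phi).
    apply: continuous_compact => //; apply: continuous_subspaceT => x.
    exact: continuous_aff.
  apply/seteqP; split => x.
    by move=> sx; exists (aff c k x) => //; rewrite affK.
  by move=> [y sy <-]; rewrite /preimage/= affVK.
by rewrite supp_aff// => x /sU.
Qed.

Lemma partial_supp phi i x : ~ supp phi x -> partial i phi x = 0.
Proof.
move=> nx; rewrite /partial (@near_eq_derive _ _ _ _ (cst 0)).
  exact: derive_val.
have : nbhs x (~` supp phi).
  by apply: open_nbhs_nbhs; split => //; apply: closed_openC; exact: closed_closure.
apply: filterS => z nz; apply: contra_notP nz => /eqP z0; exact: subset_closure.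
Qed.

Lemma grad_perp_supp phi x : ~ supp phi x -> grad_perp phi x = 0.
Proof.
by move=> nx; apply/matrixP => i j; rewrite !mxE !partial_supp// oppr0; case: ifP.
Qed.

(** A cutoff supported in U has zero gradient elsewhere, so it does not see the
    larger domain. *)
Lemma int_grad_perp_sub Om U (A : R * R -> 'M[R]_2) phi : U `<=` Om -> supp phi `<=` U ->
  int_grad_perp Om A phi = int_grad_perp U A phi.
Proof.
move=> UO sU; apply/matrixP => i j; rewrite !mxE /Rintegral; congr fine.
rewrite integral_mkcond [RHS]integral_mkcond; congr integral.
apply/funext => x; rewrite !patchE.
case: (pselect (supp phi x)) => [/[dup] /sU Ux _|/grad_perp_supp ->].
  by rewrite !mem_set//; exact: UO.
by rewrite mulmx0 mxE; do 2 case: ifP.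
Qed.

Lemma test_funS U V phi : U `<=` V -> test_fun U phi -> test_fun V phi.
Proof. by move=> UV [? ? ?]; split => //; exact: subset_trans UV. Qed.

(** Shrinking the domain and enlarging S leaves fewer curves and fewer cutoffs to
    test. *)
Lemma admissible_restrict tau eps Om U (A : R * R -> 'M[R]_2) S S' :
  open Om -> open U -> U `<=` Om -> admissible tau eps Om A S ->
  relatively_closed U S' -> S `&` U `<=` S' ->
  admissible tau eps U A S'.
Proof.
move=> oO oU UO [LA _ sC ci] rc SS'; split => //.
- move=> i j; apply: integrableS (LA i j) => //; exact: open_measurable2.
- move=> x [Ux nx]; apply: SS'; split => //; apply: sC; split; first exact: UO.
  apply: contra_not nx => -[V [oV VO Vx hV]].
  exists (V `&` U); split => //; first exact: openI.
  move=> phi tphi; have [_ _ sVU] := tphi.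
  rewrite -(int_grad_perp_sub A UO) => [|y /sVU[]//].
  by apply: hV; apply: test_funS tphi.
- move=> gamma v sg rg gU [D [phi [[oD DU bD] [tphi phi1 sphi ve]]]].
  have US : U `\` S' `<=` Om `\` S.
    by move=> x [Ux nS]; split; [exact: UO|move=> Sx; apply: nS; exact: SS'].
  apply: (ci gamma v sg rg); first exact: subset_trans US.
  exists D, phi; split; split => //.
  + exact: subset_trans UO.
  + exact: test_funS tphi.
  + exact: subset_trans US.
  + by rewrite (int_grad_perp_sub A UO)//; case: tphi.
Qed.

End testfun.

(** * Dilation of admissible pairs *)

Section scaling.
Context {R : realType}.
Notation mR := (measurableTypeR R).
Implicit Types (Om U S E D : set (R * R)) (x y c : R * R) (phi : R * R -> R)
  (A : R * R -> 'M[R]_2) (gamma : R -> R * R).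

Lemma integralZ_pos d (T : measurableType d) (mu : {measure set T -> \bar R}) (D : set T)
    (k : R) (f : T -> \bar R) : measurable D -> 0 < k -> measurable_fun D f ->
  (\int[mu]_(x in D) (k%:E * f x) = k%:E * \int[mu]_(x in D) f x)%E.
Proof.
move=> mD k0 mf; rewrite [LHS]integralE [in RHS]integralE.
rewrite (ge0_funeposM _ (ltW k0)) (ge0_funenegM _ (ltW k0)).
rewrite !(ge0_integralZl_EFin _ mD)//; [|exact: measurable_funeneg|exact: ltW|exact: measurable_funepos|exact: ltW].
exact/esym/gt0_muleBr.
Qed.

Lemma measurable_grad_perp U A phi i : smooth phi -> open U -> L1_field U A ->
  measurable_fun (U : set (mR * mR)) (fun x : mR * mR => ((A x *m grad_perp phi x) i 0)).
Proof.
move=> sm oU LA.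
have mp j : measurable_fun (U : set (mR * mR)) (fun x : mR * mR => partial j phi x).
  apply: measurable_funTS; apply: continuous_measurable2; exact: (sm [:: j]).1.
rewrite (_ : (fun x : mR * mR => _) =
  (fun x => A x i 0 * partial 1 phi x - A x i 1 * partial 0 phi x)).
  apply: measurable_funB; apply: measurable_funM => //; exact: measurable_L1_field.
apply/funext => x; rewrite mxE !big_ord_recl big_ord0 !mxE/=.
by rewrite (_ : lift ord0 ord0 = 1) ?addr0 ?mulrN//; apply: val_inj.
Qed.

(** Area contributes k^2 and the gradient 1 / k. *)
Lemma int_grad_perp_aff c k (k0 : 0 < k) U A phi : open U -> L1_field U A -> smooth phi ->
  int_grad_perp U A phi = k *: int_grad_perp (aff c k @^-1` U) (A \o aff c k)
      (phi \o aff c k).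
Proof.
move=> oU LA sm; apply/matrixP => i j; rewrite !mxE /Rintegral.
have kn0 := lt0r_neq0 k0.
pose F y := ((A y *m grad_perp phi y) i 0)%:E.
have mU : measurable (U : set (mR * mR)) by exact: open_measurable2.
have mF : measurable_fun (U : set (mR * mR)) (F : mR * mR -> _).
  apply/measurable_EFinP; exact: measurable_grad_perp.
have E1 := integral_aff c k0 mU mF.
have E2 : (\int[leb2]_(x in aff c k @^-1` U)
   (((A \o aff c k) x *m grad_perp (phi \o aff c k) x) i 0)%:E =
   k%:E * \int[leb2]_(x in aff c k @^-1` U) F (aff c k x))%E.
  transitivity (\int[leb2]_(x in aff c k @^-1` U) (k%:E * F (aff c k x)))%E.
    apply: eq_integral => x _; rewrite /F -EFinM; congr EFin.
    have -> : grad_perp (phi \o aff c k) x = k *: grad_perp phi (aff c k x).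
      apply/matrixP => a b; rewrite !mxE !partial_aff//; try exact: (sm [::]).2.
      by case: ifP; rewrite ?mulrN.
    by rewrite -scalemxAr mxE.
  apply: (@integralZ_pos _ _ leb2 (aff c k @^-1` U) k (F \o aff c k)) => //.
    exact: measurable_preimage_aff.
  exact: measurable_fun_aff.
apply: (eq_trans (congr1 fine E1)).
apply: (eq_trans _ (congr1 (fun t => k * fine t) (esym E2))).
move: (integral _ _ _) => [r| |] /=.
- by rewrite mulrA expr2.
- by rewrite !gt0_muley ?lte_fin ?exprn_gt0//= mulr0.
- by rewrite !gt0_muleNy ?lte_fin ?exprn_gt0//= mulr0.
Qed.

Lemma smooth_affV c k (k0 : k != 0) phi : smooth phi -> smooth (phi \o affV c k).
Proof. by move=> sm; apply: smooth_aff => //; rewrite invr_eq0. Qed.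

Lemma anticlockwise_aff c k (k0 : 0 < k) gamma D D' :
  D' `<=` aff c k @` D -> anticlockwise gamma D -> anticlockwise (aff c k \o gamma) D'.
Proof.
move=> DD' ac _ /DD'[p Dp <-].
have [rho [theta [ct h e]]] := ac p Dp.
exists (fun t => k * rho t), theta; split => // t /h[r0 gt].
split; first exact: mulr_gt0.
by rewrite /= gt /aff/=; congr pair; ring.
Qed.

(** A dilation moves the centre and stretches the radius of a polar
    parametrisation, but keeps its angle. *)
Lemma curve_sgn_aff c k (k0 : 0 < k) gamma D :
  curve_sgn (aff c k \o gamma) (affV c k @^-1` D) = curve_sgn gamma D.
Proof.
have kn0 := lt0r_neq0 k0.
rewrite /curve_sgn; have -> // : anticlockwise (aff c k \o gamma)
    (affV c k @^-1` D) = anticlockwise gamma D.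
apply/propext; split; last first.
  by apply: anticlockwise_aff => // y Dy; exists (affV c k y) => //; rewrite affVK.
move=> ac; have k0' : 0 < k^-1 by rewrite invr_gt0.
rewrite (_ : gamma = affV c k \o (aff c k \o gamma)); last first.
  by apply/funext => t; rewrite /= affK.
apply: (anticlockwise_aff k0' _ ac) => y Dy; exists (aff c k y); last exact: affK.
by rewrite /preimage/= affK.
Qed.

Lemma rectifiable_aff c k (k0 : 0 < k) gamma : rectifiable gamma ->
    rectifiable (aff c k \o gamma).
Proof.
move=> [M hM]; exists (k * M) => s ss /=.
under eq_bigr do rewrite eucl_dist_aff//.
by rewrite -mulr_sumr ler_pM2l//; exact: hM.
Qed.

Lemma simple_closed_curve_aff c k (k0 : 0 < k) gamma :
  simple_closed_curve gamma -> simple_closed_curve (aff c k \o gamma).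
Proof.
move=> [cg g01 inj]; split => /=; last 2 first.
- by rewrite g01.
- by move=> x y hx hy /(can_inj (affK c (lt0r_neq0 k0))); exact: inj.
move=> x; exact: (@continuous_comp _ _ _ (gamma : subspace `[0, 1] -> R * R)
  (aff c k : R * R -> R * R) x (cg x) (@continuous_aff _ c k _)).
Qed.

(** A dilation by k multiplies circulations by k, and with them the quantum
    tau * eps of the admissible ones. *)
Lemma admissible_aff tau eps c k (k0 : 0 < k) U A S : open U ->
  admissible tau eps U A S ->
  admissible tau (eps / k) (aff c k @^-1` U) (A \o aff c k) (aff c k @^-1` S).
Proof.
move=> oU [LA [C cC SC] sC ci].
have kn0 := lt0r_neq0 k0.
have ca : continuous (aff c k : R * R -> R * R) by exact: continuous_aff.
have cV : continuous (affV c k : R * R -> R * R) by exact: continuous_aff.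
have oU' : open (aff c k @^-1` U : set (R * R)) by exact: open_comp.
have affVaff phi : (phi \o affV c k) \o aff c k = phi.
  by apply/funext => x; rewrite /= affK.
have ige phi : smooth phi ->
    int_grad_perp U A (phi \o affV c k) = k *: int_grad_perp (aff c k @^-1` U)
        (A \o aff c k) phi.
  move=> sm; rewrite (int_grad_perp_aff c k0 oU LA) ?affVaff//.
  exact: smooth_affV.
have tfV V phi : test_fun (aff c k @^-1` V) phi -> test_fun V (phi \o affV c k).
  have kV0 : k^-1 != 0 by rewrite invr_eq0.
  move=> /(test_fun_aff (- (k^-1 * c.1), - (k^-1 * c.2)) kV0); apply: test_funS => y /=.
  by rewrite -/(affV c k) affVK.
split.
- have mU : measurable (U : set (mR * mR)) by exact: open_measurable2.
  by move=> i j; exact: (integrable_aff c k0 mU (LA i j)).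
- by exists (aff c k @^-1` C); [exact: closed_comp|rewrite SC].
- move=> x [Ux nx]; apply: sC; split => //.
  apply: contra_not nx => -[V [oV VU Vx hV]].
  exists (aff c k @^-1` V); split => //.
  + exact: open_comp.
  + by move=> y /VU.
  + move=> phi tphi; have := hV _ (tfV _ _ tphi).
    rewrite ige; last by case: tphi.
    by move/eqP; rewrite scaler_eq0 (negbTE kn0) => /eqP.
- move=> gamma v sg rg gU [D [phi [[oD DU bD] [tphi phi1 sphi ve]]]].
  have kV0 : k^-1 != 0 by rewrite invr_eq0.
  have [z vz] : exists z : 'cV[int]_2, k *: v = (tau * eps) *: map_mx intr z.
    apply: (ci (aff c k \o gamma)).
    + exact: simple_closed_curve_aff.
    + exact: rectifiable_aff.
    + by move=> _ [t ht <-]; apply: gU; exists t.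
    + exists (affV c k @^-1` D), (phi \o affV c k); split; split.
      * exact: open_comp.
      * by move=> y /DU /=; rewrite affVK.
      * rewrite /boundary closure_preimage_aff// interior_preimage_aff//.
        rewrite -/(affV c k) -[_ `\` _]/(affV c k @^-1` boundary D) bD.
        apply/seteqP; split => y.
          by move=> [t ht e]; exists t => //; rewrite /= e affVK.
        by move=> [t ht <-]; exists t => //; rewrite /= affK.
      * exact: tfV.
      * by move=> x; exact: phi1.
      * rewrite supp_aff// => y [/= sy nD].
        have /= := sphi (affV c k y) (conj sy nD).
        by rewrite affVK.
      * have [sm _ _] := tphi; have sE := curve_sgn_aff c k0 gamma D.
        rewrite sE (ige phi sm) ve scalerN !scalerA; congr (- (_ *: _)).
        exact: mulrC.
  exists z; rewrite mulrA mulrC -scalerA -vz scalerA mulVf// scale1r//.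
Qed.

Lemma nbhd_in_aff c k (k0 : 0 < k) U S lam eps :
  nbhd_in (aff c k @^-1` U) (lam * (eps / k)) (aff c k @^-1` S) =
  aff c k @^-1` (nbhd_in U (lam * eps) S).
Proof.
have kn0 := lt0r_neq0 k0.
apply/seteqP; split => x /=.
  move=> /nbhd_inE[Ux [y Sy xy]]; apply/nbhd_inE; split => //; exists (aff c k y) => //.
  by rewrite eucl_dist_aff// mulrC -ltr_pdivlMr// -mulrA.
move=> /nbhd_inE[Ux [y Sy xy]]; apply/nbhd_inE; split => //; exists (affV c k y).
  by rewrite /preimage/= affVK.
by rewrite mulrA ltr_pdivlMr// mulrC -(eucl_dist_aff c)// affVK.
Qed.

Lemma energy_aff c k (k0 : 0 < k) U S A lam eps : open U -> L1_field U A ->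
  (energy lam eps U A S U = (k ^+ 2)%:E *
  energy lam (eps / k) (aff c k @^-1` U) (A \o aff c k) (aff c k @^-1` S)
      (aff c k @^-1` U))%E.
Proof.
move=> oU LA; rewrite /energy nbhd_in_aff//.
have mU : measurable (U : set (mR * mR)) by exact: open_measurable2.
have mB : measurable (nbhd_in U (lam * eps) S : set (mR * mR))
    by exact: measurable_nbhd_in.
rewrite (leb2_aff c k0); last exact: measurableI.
rewrite (ge0_integral_aff c k0); last 3 first.
- exact: measurableD.
- apply: (measurable_energy_density oU LA); [by move=> x []|exact: measurableD].
- by move=> y _; rewrite lee_fin sqr_ge0.
rewrite -muleDr//.
by apply: ge0_adde_def; rewrite inE//; apply: integral_ge0 => x _;
    rewrite lee_fin sqr_ge0.
Qed.

Lemma preimage_square c k (k0 : 0 < k) : aff c k @^-1` (square c (k / 2)) = Q 2^-1.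
Proof.
apply/seteqP; split => x; rewrite Q_square /aff/square/=; nra.
Qed.

End scaling.

(** * Integrals of derivatives against piecewise constant fields *)

Section step.
Context {R : realType}.
Notation mR := (measurableTypeR R).
Notation leb1 := (@lebesgue_measure R).

Lemma integral_derivative (g g' : R -> R) (k a b : R) : a < b ->
  (forall t, is_derive t (1:R) g (g' t)) -> continuous g' ->
  (\int[leb1]_(t in `[a, b]) (k * g' t)%:E = (k * g b - k * g a)%:E)%E.
Proof.
move=> ab dg cg'.
have dkg t : is_derive t (1:R) (k \*: g) (k * g' t) by apply: is_deriveZ.
have ckg : continuous (k \*: g).
  by move=> t; apply: differentiable_continuous; apply/derivable1_diffP; have [] := dkg t.
rewrite (@continuous_FTC2 _ _ (k \*: g) _ _ ab) ?EFinB//.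
- apply: continuous_subspaceT => t; apply: cvgMr; exact: cg'.
- split=> [t _||]; first by have [] := dkg t.
  + exact/cvg_at_right_filter/ckg.
  + exact/cvg_at_left_filter/ckg.
- by move=> t _; rewrite derive1E; have [] := dkg t.
Qed.

Lemma measurable_step (am ap : R) :
  measurable_fun (setT : set mR) (fun t : mR => if (t : R) < 0 then am else ap).
Proof.
apply: measurable_fun_ifT => //; apply: measurable_fun_ltr => //.
Qed.

(** The fundamental theorem of calculus on each side of 0: only the jump at 0
    contributes. *)
Lemma integral_step_derivative (g g' : R -> R) (am ap a b : R) : a < 0 -> 0 < b ->
  (forall t, is_derive t (1:R) g (g' t)) -> continuous g' ->
  g a = 0 -> g b = 0 -> (forall t, ~ (a < t < b) -> g' t = 0) ->
  (\int[leb1]_t ((if t < 0 then am else ap) * g' t)%:E = ((am - ap) * g 0)%:E)%E.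
Proof.
move=> a0 b0 dg cg' ga gb g'0.
have mg' : measurable_fun (setT : set mR) g' by exact: continuous_measurable_fun.
have mk k D : measurable_fun (D : set mR) (fun t => k * g' t).
  by apply: measurable_funTS; apply: measurable_funM.
transitivity (\int[leb1]_(t in `[a, b]) ((if t < 0 then am else ap) * g' t)%:E)%E.
  rewrite [RHS]integral_mkcond; apply: eq_integral => t _; rewrite patchE.
  have [//|] := boolP (t \in `[a, b]%classic); rewrite notin_setE/= in_itv/= => tab.
  rewrite g'0 ?mulr0// => /andP[ta tb]; apply: tab; by rewrite !ltW.
have -> : `[a, b]%classic = `[a, 0[%classic `|` `[0, b]%classic.
  by rewrite -itv_bndbnd_setU ?bnd_simp// ltW.
rewrite integral_setU//; last 2 first.
- apply: measurable_funTS; apply/measurable_EFinP; apply: measurable_funM => //;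
    exact: measurable_step.
- by apply/disj_setPS => t []/=; rewrite !in_itv/= => /andP[_ +] /andP[+ _]; lra.
have -> : (\int[leb1]_(t in `[a, 0%R[) ((if t < 0 then am else ap) * g' t)%:E =
    \int[leb1]_(t in `[a, 0%R]) (am * g' t)%:E)%E.
  rewrite -integral_itv_bndo_bndc; last by apply/measurable_EFinP; exact: mk.
  by apply: eq_integral => t; rewrite inE/= in_itv/= => /andP[_ ->].
have -> : (\int[leb1]_(t in `[0%R, b]) ((if t < 0 then am else ap) * g' t)%:E =
    \int[leb1]_(t in `[0%R, b]) (ap * g' t)%:E)%E.
  by apply: eq_integral => t; rewrite inE/= in_itv/= => /andP[t0 _]; rewrite ltNge t0.
rewrite !integral_derivative// ga gb -EFinD; congr EFin; ring.
Qed.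

Lemma is_derive_fst (phi : R * R -> R) (t y : R) :
  derivable phi (t, y) (basis_vec 0) ->
  is_derive t (1:R) (fun t => phi (t, y)) (partial 0 phi (t, y)).
Proof.
move=> d.
have E : (fun h : R => h^-1 *: (((fun t => phi (t, y)) \o shift t)
    (h *: (1:R)) - phi (t, y))) =
  (fun h => h^-1 *: ((phi \o shift (t, y)) (h *: basis_vec 0) - phi (t, y))).
  apply/funext => h /=; congr (_ *: (phi _ - _)).
  rewrite /shift/= -[RHS]/(h * 1 + t, h * 0 + y); congr pair; by rewrite mulr0 add0r.
by split; [rewrite /derivable E|rewrite /derive E].
Qed.

Lemma is_derive_snd (phi : R * R -> R) (x t : R) :
  derivable phi (x, t) (basis_vec 1) ->
  is_derive t (1:R) (fun t => phi (x, t)) (partial 1 phi (x, t)).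
Proof.
move=> d.
have E : (fun h : R => h^-1 *: (((fun t => phi (x, t)) \o shift t)
    (h *: (1:R)) - phi (x, t))) =
  (fun h => h^-1 *: ((phi \o shift (x, t)) (h *: basis_vec 1) - phi (x, t))).
  apply/funext => h /=; congr (_ *: (phi _ - _)).
  rewrite /shift/= -[RHS]/(h * 0 + x, h * 1 + t); congr pair; by rewrite mulr0 add0r.
by split; [rewrite /derivable E|rewrite /derive E].
Qed.

Lemma bounded_partial (U : set (R * R)) (phi : R * R -> R) i : test_fun U phi ->
  exists M, forall x, `|partial i phi x| <= M.
Proof.
move=> [sm cs _].
have : compact (partial i phi @` supp phi).
  apply: continuous_compact => //; apply: continuous_subspaceT => x.
  exact: (sm [:: i]).1.
move=> /compact_bounded[M [Mr hM]].
have M1 : M < Num.max 0 M + 1 by rewrite (@le_lt_trans _ _ (Num.max 0 M)) ?ltrDl//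
    le_max lexx orbT.
exists (Num.max 0 M + 1) => x.
have [sx|nx] := pselect (supp phi x); first by apply: (hM _ M1); exists x.
by rewrite partial_supp// normr0 addr_ge0// le_max lexx.
Qed.

Lemma square_itv c (r : R) : square c r = `]c.1 - r, c.1 + r[%classic `*` `]c.2 - r,
    c.2 + r[%classic.
Proof. by apply/seteqP; split => x /=; rewrite !in_itv. Qed.

Lemma leb2_square_lty c (r : R) : (leb2 (square c r) < +oo)%E.
Proof.
rewrite square_itv /leb2 product_measure1E//= !lebesgue_measure_itv/=.
by do 2 case: ifP => _; rewrite ?mule0 ?mul0e ?ltry// -?EFinB -?EFinM ltry.
Qed.

Lemma supp_notin (U : set (R * R)) (phi : R * R -> R) x : supp phi `<=` U -> ~ U x ->
    phi x = 0.
Proof.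
move=> sU nU; apply: contrapT => /eqP px; apply: nU; apply: sU; exact: subset_closure.
Qed.

(** Integrate first along the direction of the derivative. Vertical lines see a
    constant weight; horizontal ones see its jump, where phi vanishes. *)
Lemma integral_step_partial (phi : R * R -> R) (i : 'I_2) (am ap : R) :
  test_fun (Q 2^-1) phi -> (forall y, phi (0, y) = 0) ->
  leb2.-integrable (Q 2^-1 : set (mR * mR)) (fun x : mR * mR =>
      ((if (x.1 : R) < 0 then am else ap) * partial i phi x)%:E) /\
  (\int[leb2]_(x in Q 2^-1) ((if x.1 < 0 then am else ap) * partial i phi x)%:E = 0)%E.
Proof.
move=> tphi phi0; have [sm cs sU] := tphi.
have cp : continuous (partial i phi) by exact: (sm [:: i]).1.
pose u (x : mR * mR) := (if (x.1 : R) < 0 then am else ap) * partial i phi x.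
have mu : measurable_fun setT u.
  apply: measurable_funM; last exact: continuous_measurable2.
  exact: (measurableT_comp (measurable_step am ap)).
have mQ : measurable (Q 2^-1 : set (mR * mR)) by rewrite Q_square;
    exact: measurable_square.
have iQ : leb2.-integrable (Q 2^-1 : set (mR * mR)) (EFin \o u).
  apply: measurable_bounded_integrable => //.
  - by rewrite Q_square; exact: leb2_square_lty.
  - exact: measurable_funTS.
  - have [M hM] := bounded_partial i tphi.
    exists ((`|am| + `|ap|) * M); split; first exact: num_real.
    move=> N MN x _; rewrite /= /u normrM; apply/ltW; apply: le_lt_trans MN.
    apply: ler_pM => //; case: ifP => _; by rewrite ?lerDl ?lerDr.
split => //.
have uQ : (EFin \o u) \_ (Q 2^-1) = EFin \o u.
  apply/funext => x; rewrite patchE; case: (pselect (Q 2^-1 x)) => Qx.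
    by rewrite mem_set.
  rewrite memNset// /comp (_ : u x = 0)// /u partial_supp ?mulr0//.
  by move=> /sU.
have iT : leb2.-integrable setT (EFin \o u).
  by rewrite -uQ; exact: (integrable_mkcond _ mQ).1.
rewrite integral_mkcond (_ : _ \_ _ = EFin \o u)//.
rewrite -(integral12_prod_meas1 iT) /fubini_F.
have v1 (x y : R) : ~ (- 2^-1 < x < 2^-1 /\ - 2^-1 < y < 2^-1) -> phi (x, y) = 0.
  by move=> n; apply: (supp_notin sU).
have v2 (x y : R) : ~ (- 2^-1 < x < 2^-1 /\ - 2^-1 < y < 2^-1) -> partial i phi (x,
    y) = 0.
  by move=> n; apply: partial_supp => /sU.
have h2 : 0 < 2^-1 :> R by rewrite invr_gt0.
have h2' : - 2^-1 < 0 :> R by rewrite oppr_lt0.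
have dphi j x : derivable phi x (basis_vec j) by exact: (sm [::]).2.
case: (ord2 i) => i01; subst i.
- rewrite (Fubini iT) integral0_eq// => y _.
  have H := @integral_step_derivative (fun t => phi (t, y)) _ am ap _ _ h2' h2
    (fun t => is_derive_fst (dphi 0 (t, y))).
  apply: (eq_trans (H _ _ _ _)).
  + move=> t; apply: (@continuous_comp _ _ _ (fun t : R => (t, y)) (partial 0 phi));
      last exact: cp.
    exact: (@cvg_pair _ _ _ (nbhs t) (nbhs t) (nbhs y) _ _ _ id (cst y) cvg_id
        (@cvg_cst _ _ _ _ _)).
  + by apply: (v1 (- 2^-1) y); rewrite ltxx => -[].
  + by apply: (v1 (2^-1) y); rewrite ltxx andbF => -[].
  + by move=> t nt; apply: (v2 t y) => -[].
  + by rewrite phi0 mulr0.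
- rewrite integral0_eq// => x _.
  have H a := @integral_step_derivative (fun t => phi (x, t)) _ a a _ _ h2' h2
    (fun t => is_derive_snd (dphi 1 (x, t))).
  apply: (eq_trans _ (eq_trans (H (if x < 0 then am else ap) _ _ _ _) _)).
  + by apply: eq_integral => y _; rewrite if_same.
  + move=> t; apply: (@continuous_comp _ _ _ (fun t : R => (x, t)) (partial 1 phi));
      last exact: cp.
    exact: (@cvg_pair _ _ _ (nbhs t) (nbhs x) (nbhs t) _ _ _ (cst x) id (@cvg_cst _ _ _
        _ _) cvg_id).
  + by apply: (v1 x (- 2^-1)); rewrite ltxx => -[].
  + by apply: (v1 x 2^-1); rewrite ltxx andbF => -[].
  + by move=> t nt; apply: (v2 x t) => -[].
  + by rewrite subrr mul0r.
Qed.

(** The curl of the interface field is concentrated on the axis, hence not seen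
    by a cutoff that vanishes there. *)
Lemma int_grad_perp_interface (Rm Rp : 'M[R]_2) (phi : R * R -> R) :
  test_fun (Q 2^-1) phi -> (forall y, phi (0, y) = 0) ->
  int_grad_perp (Q 2^-1) (interface Rm Rp) phi = 0.
Proof.
move=> tphi phi0; apply/matrixP => i j; rewrite !mxE /Rintegral.
have [i1 e1] := integral_step_partial 1 (Rm i 0) (Rp i 0) tphi phi0.
have [i0 e0] := integral_step_partial 0 (Rm i 1) (Rp i 1) tphi phi0.
have mQ : measurable (Q 2^-1 : set (mR * mR)) by rewrite Q_square;
    exact: measurable_square.
transitivity (fine (\int[leb2]_(x in Q 2^-1) (((if x.1 < 0 then Rm i 0 else Rp i 0) *
    partial 1 phi x)%:E
  - ((if x.1 < 0 then Rm i 1 else Rp i 1) * partial 0 phi x)%:E)))%E.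
  congr fine; apply: eq_integral => x _; rewrite -EFinB; congr EFin.
  rewrite mxE !big_ord_recl big_ord0 !mxE/= /interface (_ : lift ord0 ord0 = 1);
      last exact: val_inj.
  by rewrite addr0 mulrN; case: ifP.
rewrite (integralB_EFin mQ i1 i0).
by rewrite e1 e0 sube0.
Qed.

End step.

(** * The L^1 distance to the interface and the segment competitor *)

Section L1dist.
Context {R : realType}.
Notation mR := (measurableTypeR R).
Implicit Types (Om U S E D : set (R * R)) (x y c : R * R) (A : R * R -> 'M[R]_2).

Definition L1dist (lam eps : R) Om A S (Rm Rp : 'M[R]_2) : \bar R :=
  (\int[leb2]_(x in Om) (frobenius (\1_(Om `\` nbhd_in Om (lam * eps) S) x *: A x
     - interface Rm Rp x))%:E)%E.

Lemma measurable_interface (D : set (mR * mR)) (Rm Rp : 'M[R]_2) i j :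
  measurable_fun D (fun x : mR * mR => interface Rm Rp x i j).
Proof.
rewrite (_ : (fun x : mR * mR => _) = (fun x => if (x.1 : R) < 0 then Rm i j else Rp i
    j)).
  apply: measurable_funTS; exact: (measurableT_comp (measurable_step (Rm i j) (Rp i j))).
by apply/funext => x; rewrite /interface; case: ifP.
Qed.

Lemma measurable_L1dist_density Om D A (Rm Rp : 'M[R]_2) : L1_field Om A ->
  measurable (D : set (mR * mR)) ->
  measurable_fun (Om : set (mR * mR)) (fun x : mR * mR =>
      (frobenius (\1_D x *: A x - interface Rm Rp x))%:E).
Proof.
move=> LA mD; apply/measurable_EFinP; apply: measurable_frobenius => i j.
rewrite (_ : (fun x : mR * mR => _) = (fun x => \1_D x * A x i j - interface Rm Rp x i
    j)); last first.
  by apply/funext => x; rewrite !mxE.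
apply: measurable_funB; last exact: measurable_interface.
apply: measurable_funM; last exact: measurable_L1_field.
exact: measurable_indic.
Qed.

Lemma SO2_interface (Rm Rp : 'M[R]_2) x : SO2 Rm -> SO2 Rp -> SO2 (interface Rm Rp x).
Proof. by rewrite /interface; case: ifP. Qed.

Lemma frobenius_SO2 (M : 'M[R]_2) : SO2 M -> frobenius (- M) = Num.sqrt 2.
Proof.
move=> /SO2_entries[T11 T10 T1]; rewrite frobeniusE !mxE T11 T10; congr Num.sqrt; lra.
Qed.

(** Outside the new neighbourhood both integrands agree; inside, the new one is the
    norm of a rotation, sqrt 2. *)
Lemma L1dist_le lam eps Om U A S S' (Rm Rp : 'M[R]_2) : open Om -> open U -> U `<=` Om ->
  L1_field Om A -> SO2 Rm -> SO2 Rp ->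
  nbhd_in Om (lam * eps) S `&` U `<=` nbhd_in U (lam * eps) S' ->
  (L1dist lam eps U A S' Rm Rp <=
    L1dist lam eps Om A S Rm Rp + (Num.sqrt 2)%:E * leb2 (nbhd_in U (lam * eps) S'))%E.
Proof.
move=> oO oU UO LA sm sp BB.
have mO : measurable (Om : set (mR * mR)) by exact: open_measurable2.
have mU : measurable (U : set (mR * mR)) by exact: open_measurable2.
have mB : measurable (nbhd_in Om (lam * eps) S : set (mR * mR))
    by exact: measurable_nbhd_in.
have mB' : measurable (nbhd_in U (lam * eps) S' : set (mR * mR))
    by exact: measurable_nbhd_in.
have f0 D (x : mR * mR) : (0 <= (frobenius (\1_D x *: A x - interface Rm Rp x))%:E)%E.
  by rewrite lee_fin sqrtr_ge0.
have LAU : L1_field U A by move=> i j; apply: integrableS (LA i j).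
set B := nbhd_in Om _ _ in BB mB *; set B' := nbhd_in U _ _ in BB mB' *.
have mf1 := measurable_L1dist_density Rm Rp LA (measurableD mO mB).
have mf2 := measurable_L1dist_density Rm Rp LAU (measurableD mU mB').
have mf3 := measurable_funS mO UO mf1.
have mi : measurable_fun (U : set (mR * mR)) (fun x : mR * mR => (\1_B' x : R)%:E).
  by apply/measurable_EFinP; apply: measurable_funTS; exact: measurable_indic.
apply: (@le_trans _ _ (\int[leb2]_(x in U) (frobenius (\1_(Om `\` B) x *: A x -
    interface Rm Rp x))%:E
   + \int[leb2]_(x in U) ((Num.sqrt 2)%:E * (\1_B' x : R)%:E))%E); last first.
  apply: leeD.
    by apply: ge0_subset_integral => // x _; exact: f0.
  rewrite (ge0_integralZl_EFin leb2 mU _ mi (sqrtr_ge0 2)); last first.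
    by move=> x _; rewrite lee_fin.
  have -> : (\int[leb2]_(x in U) (\1_B' x : R)%:E = leb2 (B' `&` U))%E.
    exact: (integral_indic leb2 mU mB').
  rewrite (_ : B' `&` U = B')//.
  by apply/seteqP; split=> [x []|x B'x]//; split=> //; case: B'x.
have mi2 := measurable_funeM (Num.sqrt 2)%:E mi.
have i20 x : (0 <= (Num.sqrt 2)%:E * (\1_B' x : R)%:E)%E by rewrite mule_ge0// lee_fin.
rewrite -ge0_integralD//; apply: ge0_le_integral => //.
- exact: emeasurable_funD.
- move=> x Ux; rewrite -EFinM -EFinD lee_fin.
  have [B'x|nB'x] := pselect (B' x).
    rewrite (_ : \1_(U `\` B') x = 0) ?scale0r ?sub0r; last first.
      by rewrite indicE memNset// => -[].
    rewrite frobenius_SO2; last exact: SO2_interface.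
    by rewrite (_ : \1_B' x = 1) ?mulr1 ?lerDr ?sqrtr_ge0// indicE mem_set.
  rewrite (_ : \1_(U `\` B') x = 1); last by rewrite indicE mem_set.
  rewrite (_ : \1_(Om `\` B) x = 1) ?lerDl ?mulr_ge0//.
  rewrite indicE mem_set//; split; [exact: UO|move=> Bx; apply: nB'x; exact: BB].
Qed.

End L1dist.

Section interface_competitor.
Context {R : realType}.
Notation mR := (measurableTypeR R).
Variables (Rm Rp : 'M[R]_2).
Hypotheses (SO2_Rm : SO2 Rm) (SO2_Rp : SO2 Rp).

(** The singular set of the segment competitor, that is the interface itself. *)
Definition seam : set (R * R) := [set x | x.1 = 0] `&` Q 2^-1.

Lemma closed_axis : closed [set x : R * R | x.1 = 0].
Proof.
apply: (@closed_comp _ _ (fst : R * R -> R) [set 0]); last exact: closed_eq.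
by move=> x _; exact: cvg_fst.
Qed.

Lemma L1_field_interface c r : L1_field (square c r) (interface Rm Rp).
Proof.
move=> i j; apply: measurable_bounded_integrable.
- exact: measurable_square.
- exact: leb2_square_lty.
- exact: measurable_interface.
exists (`|Rm i j| + `|Rp i j|); split; first exact: num_real.
move=> N MN x _; apply/ltW; apply: le_lt_trans MN.
by rewrite /= /interface; case: ifP => _; rewrite ?lerDl ?lerDr.
Qed.

(** An admissible cutoff vanishes on the segment, which makes all circulations
    zero. If it did not, the region D enclosed by the curve would meet the
    segment; as the curve avoids the segment, D would contain the segment up to
    its end, and the support of the cutoff, which contains D, would not be a
    compact subset of the domain. *)
Lemma admissible_interface tau eps : admissible tau eps (Q 2^-1) (interface Rm Rp) seam.
Proof.
split.
- by rewrite Q_square; exact: L1_field_interface.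
- by exists [set x | x.1 = 0] => //; exact: closed_axis.
- move=> x [Qx nx]; split => //; apply: contrapT => x0; apply: nx.
  exists (Q 2^-1 `&` ~` [set x | x.1 = 0]); split => //.
  + apply: openI; first by rewrite Q_square; exact: open_square.
    by apply: closed_openC; exact: closed_axis.
  + move=> phi tphi; apply: int_grad_perp_interface.
      by apply: test_funS tphi.
    by move=> y; case: tphi => _ _ sU; apply: (supp_notin sU) => -[_]; apply.
- move=> gamma v sg rg gU [D [phi [[oD DU bD] [tphi phi1 sphi ve]]]].
  exists 0; rewrite map_mx0 scaler0 ve int_grad_perp_interface ?scaler0 ?oppr0//.
  move=> y; apply: contrapT => /eqP phiy; have [_ _ sQ] := tphi.
  have suppD : closure D `<=` supp phi.
    by apply: closure_subset => z Dz; rewrite /= phi1// oner_neq0.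
  have sy : supp phi (0, y) by exact: subset_closure.
  have Dy : D (0, y).
    by apply: contrapT => nD; have [_] := sphi _ (conj sy nD); apply; split => //;
        exact: sQ.
  pose E := [set t : R | D (0, t)].
  have supE : has_sup E.
    split; first by exists y.
    by exists 2^-1 => t /DU[_ /andP[_ /ltW]].
  (* (0, sup E) is the upper end of the part of the segment in D *)
  have cs : closure D (0, sup E).
    move=> V /nbhs_ballP[e /= e0 eV].
    have [t Dt te] := sup_adherent e0 supE.
    exists (0, t); split => //; apply: eV; split => /=; first exact: ballxx.
    have ts : t <= sup E by apply: ub_le_sup => //; case: supE.
    by rewrite -ball_normE /ball_/= ger0_norm ?subr_ge0//; lra.
  have Ds : D (0, sup E).
    apply: contrapT => nD.
    have : boundary D (0, sup E).
      by split => // /interior_subset.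
    rewrite bD => -[t ht gt]; have [_] := gU _ (ex_intro2 _ _ t ht gt).
    by apply; split => //; apply: sQ; exact: suppD.
  have /nbhs_ballP[e /= e0 eD] : nbhs (0 : R, sup E) D by exact: open_nbhs_nbhs.
  have : E (sup E + e / 2).
    apply: eD; split => /=; first exact: ballxx.
    rewrite -ball_normE /ball_/= opprD addNKr normrN gtr0_norm ?divr_gt0//.
    by rewrite ltr_pdivrMr// mulr2n mulrDr mulr1 ltrDl.
  move=> /(@ub_le_sup _ E); have [_ hu] := supE => /(_ hu).
  by rewrite gerDl leNgt divr_gt0.
Qed.

End interface_competitor.

(** * The optimal energy as a uniform lower bound *)

Section psi0.
Context {R : realType}.
Notation mR := (measurableTypeR R).
Variables (lam tau : R) (lam_gt0 : 0 < lam).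
Variables (Rm Rp : 'M[R]_2) (SO2_Rm : SO2 Rm) (SO2_Rp : SO2 Rp).

Lemma rect_itv (a b : R) : rect a b = `](- a), a[%classic `*` `](- b), b[%classic.
Proof. by apply/seteqP; split => x /=; rewrite !in_itv. Qed.

Lemma leb2_rect (a b : R) : 0 < a -> 0 < b -> leb2 (rect a b) = (4 * a * b)%:E.
Proof.
move=> a0 b0; rewrite rect_itv /leb2 product_measure1E//= !lebesgue_measure_itv/=
    !lte_fin.
rewrite !ifT ?(lt_trans _ a0) ?(lt_trans _ b0) ?oppr_lt0//.
by rewrite -!EFinB -EFinM; congr EFin; ring.
Qed.

Lemma limf_einf_le (T : choiceType) (X : filteredType T) (f : X -> \bar R)
    (F : set (set X)) M :
  (forall V, F V -> exists2 x, V x & (f x <= M)%E) -> (limf_einf f F <= M)%E.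
Proof.
move=> H; rewrite limf_einfE; apply: ge_ereal_sup => _ [V FV <-].
have [x Vx fx] := H V FV; apply: le_trans fx.
by apply: ereal_inf_lbound; exists x.
Qed.

Lemma cvge0_le (T : Type) (F : set_system T) {FF : Filter F} (g : T -> \bar R) :
  (forall k, 0 < k -> \forall t \near F, (0 <= g t <= k%:E)%E) -> g @ F --> 0%E.
Proof.
move=> H; apply/fine_cvgP; split.
  apply: filterS (H 1 ltr01) => t /andP[g0 g1].
  by rewrite ge0_fin_numE// (le_lt_trans g1)// ltry.
apply/cvgrPdist_le => k k0; apply: filterS (H k k0) => t /= /andP[].
by case: (g t) => [r| |]//=; rewrite !lee_fin => r0 rk; rewrite sub0r normrN ger0_norm.
Qed.

Lemma leb2_nbhd_seam eps : 0 < eps ->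
  (leb2 (nbhd_in (Q 2^-1) (lam * eps) seam) <= (2 * lam * eps)%:E)%E.
Proof.
move=> e0; have le0 : 0 < lam * eps by exact: mulr_gt0.
have -> : 2 * lam * eps = 4 * (lam * eps) * 2^-1 by field.
rewrite -leb2_rect ?invr_gt0//; apply: le_measure; rewrite ?inE.
- apply: open_measurable2; apply: open_nbhd_in; rewrite Q_square; exact: open_square.
- by rewrite rect_itv; exact: measurableX.
- move=> x /nbhd_inE[[_ x2] [y [/= y0 _] xy]]; split => //.
  by rewrite -ltr_norml -[x.1]subr0 -y0 (le_lt_trans (eucl_dist_fst _ _)).
Qed.

Lemma energy_interface_le eps : 0 < eps ->
  (energy lam eps (Q 2^-1) (interface Rm Rp) seam (Q 2^-1) <= (2 * lam * eps)%:E)%E.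
Proof.
move=> e0; rewrite /energy integral0_eq ?add0e; last first.
  by move=> x _; rewrite dist_SO2_SO2 ?expr0n//; exact: SO2_interface.
rewrite (_ : _ `&` _ = nbhd_in (Q 2^-1) (lam * eps) seam); first exact: leb2_nbhd_seam.
by apply/seteqP; split=> [x []|x Bx]//; split=> //; case: Bx.
Qed.

Lemma L1dist_interface_le eps : 0 < eps ->
  (L1dist lam eps (Q 2^-1) (interface Rm Rp) seam Rm Rp <= (Num.sqrt 2 * (2 * lam *
      eps))%:E)%E.
Proof.
move=> e0; have oQ : open (Q (2^-1 : R)) by rewrite Q_square; exact: open_square.
have n0 : nbhd_in (Q (2^-1 : R)) (lam * eps) set0 = set0.
  by apply/seteqP; split=> // x /nbhd_inE[_ []].
have LI : L1_field (Q 2^-1) (interface Rm Rp) by rewrite Q_square;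
    exact: L1_field_interface.
have B0 : nbhd_in (Q 2^-1) (lam * eps) set0 `&` Q (2^-1 : R) `<=` nbhd_in (Q 2^-1)
    (lam * eps) seam.
  by rewrite n0 set0I.
apply: (le_trans (L1dist_le oQ oQ (@subset_refl _ _) LI SO2_Rm SO2_Rp B0)).
rewrite /L1dist integral0_eq ?add0e; last first.
  move=> x Qx; rewrite n0 setD0 indicE mem_set//= scale1r subrr frobeniusE !mxE.
  by rewrite !expr0n/= !addr0 sqrtr0.
by rewrite EFinM lee_wpmul2l ?lee_fin ?sqrtr_ge0//; exact: leb2_nbhd_seam.
Qed.

Lemma interface_family_interface :
  interface_family lam tau Rm Rp (fun=> interface Rm Rp) (fun=> seam).
Proof.
split; first by move=> eps _; exact: admissible_interface.
apply: (@squeeze_cvge _ _ _ _ (cst 0%E) _ (fun eps => (Num.sqrt 2 * (2 * lam * eps))%:E)).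
- near=> e; apply/andP; split.
    by apply: integral_ge0 => x _; rewrite lee_fin sqrtr_ge0.
  by apply: L1dist_interface_le; near: e; exact: nbhs_right_gt.
- exact: cvg_cst.
- apply: cvg_EFin; first by near=> e.
  rewrite [X in _ --> X](_ : 0 = Num.sqrt 2 * (2 * lam * 0)); last by rewrite !mulr0.
  apply: cvg_at_right_filter; apply: cvgMr; apply: cvgMr; exact: cvg_id.
Unshelve. all: by end_near.
Qed.

Lemma psi0_fin : exists p : R, 0 <= p /\ psi0 lam tau Rm Rp = p%:E.
Proof.
have le : (psi0 lam tau Rm Rp <= (2 * lam)%:E)%E.
  apply: ge_ereal_inf; eexists.
    exists (fun=> interface Rm Rp), (fun=> seam); split; last reflexivity.
    exact: interface_family_interface.
  apply: limf_einf_le => V V0.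
  have [e [Ve e0]] : exists e, V e /\ 0 < e.
    have : \forall e \near 0^'+, V e /\ 0 < e by apply: filterI => //;
        exact: nbhs_right_gt.
    exact: filter_ex.
  exists e => //.
  apply: (@le_trans _ _ ((e^-1)%:E * (2 * lam * e)%:E)%E).
    by apply: lee_wpmul2l; [rewrite lee_fin invr_ge0 ltW|exact: energy_interface_le].
  by rewrite -EFinM lee_fin mulrC mulfK// lt0r_neq0.
have ge : (0 <= psi0 lam tau Rm Rp)%E.
  apply: le_ereal_inf_tmp => _ [A [S [_ ->]]].
  rewrite limf_einfE; apply: (@le_trans _ _ (ereal_inf [set
     ((eps^-1)%:E * energy lam eps (Q 2^-1) (A eps) (S eps)
         (Q 2^-1))%E | eps in [set e : R | 0 < e]])).
    apply: le_ereal_inf_tmp => _ [e e0 <-].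
    by rewrite mule_ge0 ?energy_ge0// lee_fin invr_ge0 ltW.
  apply: ereal_sup_ubound; exists [set e : R | 0 < e] => //; exact: nbhs_right_gt.
move: le ge; case: psi0 => [p| |]; rewrite ?lee_fin//.
by move=> _ p0; exists p.
Qed.

(** A lower bound uniform over all admissible pairs, with no family involved. If it
    failed for every eta = 1 / (n + 1), the counterexamples, at parameters that
    tend to 0, would form a family of energy at most c along a sequence, once
    completed by the segment competitor at the other parameters. *)
Lemma psi0_lower_bound (c : R) : (c%:E < psi0 lam tau Rm Rp)%E ->
  exists2 eta : R, 0 < eta & forall e A S, 0 < e < eta ->
    admissible tau e (Q 2^-1) A S -> (L1dist lam e (Q 2^-1) A S Rm Rp < eta%:E)%E ->
    (c%:E < (e^-1)%:E * energy lam e (Q 2^-1) A S (Q 2^-1))%E.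
Proof.
move=> cpsi; apply: contrapT => nex.
have /choice[f hf] (n : nat) : exists p : R * (R * R -> 'M[R]_2) * set (R * R),
    [/\ 0 < p.1.1 < n.+1%:R^-1, admissible tau p.1.1 (Q 2^-1) p.1.2 p.2,
      (L1dist lam p.1.1 (Q 2^-1) p.1.2 p.2 Rm Rp < (n.+1%:R^-1)%:E)%E &
      ((p.1.1^-1)%:E * energy lam p.1.1 (Q 2^-1) p.1.2 p.2 (Q 2^-1) <= c%:E)%E].
  apply: contrapT => nn; apply: nex; exists n.+1%:R^-1; first by rewrite invr_gt0.
  move=> e A S he ad L1; rewrite ltNge; apply/negP => ec; apply: nn.
  by exists (e, A, S); split.
(* idx e is some n whose counterexample has parameter e, if there is one *)
pose P (e : R) := exists n, (f n).1.1 = e.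
pose idx e := if pselect (P e) is left h then Some (projT1 (cid h)) else None.
pose Af e := if idx e is Some n then (f n).1.2 else interface Rm Rp.
pose Sf e := if idx e is Some n then (f n).2 else seam.
have idxE e n : idx e = Some n -> (f n).1.1 = e.
  by rewrite /idx; case: pselect => // h [<-]; case: cid.
have idxf n : exists m, idx (f n).1.1 = Some m.
  by rewrite /idx; case: pselect => [h|[]]; [eexists|exists n].
have fam : interface_family lam tau Rm Rp Af Sf.
  split.
    move=> e e0; rewrite /Af /Sf; case E : (idx e) => [n|];
        last exact: admissible_interface.
    by have [_ + _ _] := hf n; rewrite (idxE _ _ E).
  have [_ cI] := interface_family_interface.
  apply: cvge0_le => k k0.
  have kI : \forall e \near 0^'+, (L1dist lam e (Q 2^-1)
      (interface Rm Rp) seam Rm Rp <= k%:E)%E.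
    have /fine_cvgP[fI /cvgrPdist_le/(_ k k0) kI] := cI.
    near=> e; rewrite -[leLHS]fineK; last by near: e; exact: fI.
    rewrite lee_fin; apply: le_trans (ler_norm _) _; rewrite -normrN -[- _]sub0r.
    by near: e; exact: kI.
  have [n0 hn0] : exists n0 : nat, forall n, (n0 <= n)%N -> n.+1%:R^-1 < k.
    have [n0 _ h] := near_infty_natSinv_lt (PosNum k0).
    by exists n0 => n n0n; exact: h.
  (* e below the first n0 parameters forces idx e >= n0 *)
  have small : \forall e \near 0^'+, forall m : 'I_n0, e < (f m).1.1.
    apply: filter_forall => m; apply: nbhs_right_lt.
    by have [/andP[]] := hf m.
  near=> e; apply/andP; split.
    by apply: integral_ge0 => x _; rewrite lee_fin sqrtr_ge0.
  rewrite -/(L1dist lam e (Q 2^-1) (Af e) (Sf e) Rm Rp) /Af /Sf.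
  case E : (idx e) => [n|]; last by near: e.
  have [_ _ L1 _] := hf n; rewrite (idxE _ _ E) in L1.
  apply: (le_trans (ltW L1)); rewrite lee_fin; apply/ltW/hn0.
  rewrite leqNgt; apply/negP => nn0.
  have : forall m : 'I_n0, e < (f m).1.1 by near: e.
  by move=> /(_ (Ordinal nn0)) /=; rewrite (idxE _ _ E) ltxx.
have : (psi0 lam tau Rm Rp <= c%:E)%E; last by rewrite leNgt cpsi.
apply: ge_ereal_inf; eexists.
  by exists Af, Sf; split; [exact: fam|reflexivity].
apply: limf_einf_le => V [r /= r0 rV].
have [n _ /(_ n (leqnn n)) /= hn] := near_infty_natSinv_lt (PosNum r0).
have [/andP[en0 en] _ _ _] := hf n.
have [m Em] := idxf n.
exists (f n).1.1.
  by apply: rV => //=; rewrite sub0r normrN gtr0_norm// (lt_trans en).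
rewrite /Af /Sf Em -(idxE _ _ Em); by have [] := hf m.
Unshelve. all: by end_near.
Qed.

End psi0.

(** * Restriction to a square with control of the neighbourhood *)

Section localization.
Context {R : realType}.
Notation mR := (measurableTypeR R).
Implicit Types (A : R * R -> 'M[R]_2) (S Om : set (R * R)) (c : R * R).

Lemma L1dist_aff c k (k0 : 0 < k) lam eps U S A (Rm Rp : 'M[R]_2) : open U ->
    L1_field U A ->
  c.1 = 0 ->
  (L1dist lam eps U A S Rm Rp = (k ^+ 2)%:E *
  L1dist lam (eps / k) (aff c k @^-1` U) (A \o aff c k) (aff c k @^-1` S) Rm Rp)%E.
Proof.
move=> oU LA c0; rewrite /L1dist nbhd_in_aff//.
have mU : measurable (U : set (mR * mR)) by exact: open_measurable2.
have mB : measurable (nbhd_in U (lam * eps) S : set (mR * mR))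
    by exact: measurable_nbhd_in.
have mf := measurable_L1dist_density Rm Rp LA (measurableD mU mB).
have f0 y : U y -> (0 <= (frobenius (\1_(U `\` nbhd_in U (lam * eps) S) y *: A y -
    interface Rm Rp y))%:E)%E.
  by move=> _; rewrite lee_fin sqrtr_ge0.
apply: (eq_trans (ge0_integral_aff c k0 mU mf f0)).
apply: (congr1 (fun t => (k ^+ 2)%:E * t)%E).
apply: eq_integral => x _; congr (frobenius (_ *: _ - _))%:E.
by rewrite /interface/= c0 add0r pmulr_rlt0.
Qed.

Lemma square_subset c r r' : r <= r' -> square c r `<=` square c r'.
Proof. by move=> rr x [/andP[? ?] /andP[? ?]]; split; apply/andP; split; lra. Qed.

Lemma in_square c r x : square c r x <-> `|x.1 - c.1| < r /\ `|x.2 - c.2| < r.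
Proof.
rewrite !ltr_norml /square/=; split.
  by move=> [/andP[? ?] /andP[? ?]]; split; apply/andP; split; lra.
by move=> [/andP[? ?] /andP[? ?]]; split; apply/andP; split; lra.
Qed.

Definition band c r w := square c (r + w) `\` square c (r - w).

Lemma measurable_band c r w : measurable (band c r w : set (mR * mR)).
Proof. by apply: measurableD; exact: measurable_square. Qed.

Section fill.
Variables (lam eps : R) (Om S : set (R * R)) (c : R * R) (r : R).
Let rho := lam * eps.
Hypotheses (rho0 : 0 < rho) (oOm : open Om) (sqO : square c (r + 2 * rho) `<=` Om).
Local Notation q := (square c r).
Local Notation B := (nbhd_in Om rho S).

(** A singular set for the square that keeps the whole neighbourhood of S in it:
    S inside the square, together with the part of the neighbourhood of S near
    the boundary, closed so that the result is relatively closed. *)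
Definition fill : set (R * R) := q `&` (S `|` closure (q `&` B `\` square c (r - rho))).

Let qO : q `<=` Om.
Proof. by apply: subset_trans sqO; apply: square_subset;
    rewrite lerDl mulr_ge0// ltW. Qed.

Lemma relatively_closed_fill : relatively_closed Om S -> relatively_closed q fill.
Proof.
move=> [C cC SC]; exists (C `|` closure (q `&` B `\` square c (r - rho))).
  by apply: closedU => //; exact: closed_closure.
rewrite /fill SC; apply/seteqP; split => x.
  by move=> [qx [[Cx _]|Gx]]; split=> //; [left|right].
by move=> [[Cx|Gx] qx]; split=> //; [left; split=> //; exact: qO|right].
Qed.

Lemma subset_fill : S `&` q `<=` fill.
Proof. by move=> x [Sx qx]; split => //; left. Qed.

(** A point near some s in S is near the same s inside the square; if s is outside,
    the point is close to the boundary and belongs to the added layer. *)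
Lemma nbhd_in_fill : B `&` q `<=` nbhd_in q rho fill.
Proof.
move=> x [/[dup] Bx /nbhd_inE[Ox [s Ss xs]] qx]; apply/nbhd_inE; split => //.
have [qs|nqs] := pselect (q s); first by exists s => //; split => //; left.
exists x; last by rewrite /eucl_dist !subrr expr0n/= addr0 sqrtr0.
split => //; right; apply: subset_closure; split => // /in_square[x1 x2].
apply: nqs; apply/in_square.
have s1 := le_lt_trans (eucl_dist_fst x s) xs; have s2 :=
    le_lt_trans (eucl_dist_snd x s) xs.
move: x1 x2 s1 s2; rewrite !ltr_norml => /andP[? ?] /andP[? ?] /andP[? ?] /andP[? ?].
by split; apply/andP; split; lra.
Qed.

(** For i < 4, the centres of the four intervals of length rho that cover the
    interval (- 2 rho, 2 rho). *)
Definition grid (i : nat) : R := (i%:R - 3 / 2) * rho.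

Lemma grid_net (t : R) : `|t| < 2 * rho -> exists2 i,
    (i < 4)%N & `|t - grid i| <= rho / 2.
Proof.
rewrite ltr_norml => /andP[t1 t2].
have cl (i : nat) : (i%:R - 2) * rho <= t <= (i%:R - 1) * rho -> `|t - grid i| <= rho / 2.
  by move=> /andP[? ?]; rewrite ler_norml /grid; apply/andP; split; lra.
have [h|h] := leP t (- rho); first by exists 0%N => //; apply: cl; apply/andP; split; lra.
have [h1|h1] := leP t 0; first by exists 1%N => //; apply: cl; apply/andP; split; lra.
have [h2|h2] := leP t rho; first by exists 2%N => //; apply: cl; apply/andP; split; lra.
by exists 3%N => //; apply: cl; apply/andP; split; lra.
Qed.

Lemma near_band_le (z s b o : R) : `|b - s| < rho -> `|z - s| <= rho / 2 ->
  `|b - o| < r -> `|z - o| < r + 2 * rho.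
Proof.
rewrite ler_norml !ltr_norml => /andP[? ?] /andP[? ?] /andP[? ?].
by apply/andP; split; lra.
Qed.

Lemma near_band_ge (z s b o : R) : `|b - s| < rho -> `|z - s| <= rho / 2 ->
  `|z - o| < r - 3 * rho -> `|b - o| < r - rho.
Proof.
rewrite ler_norml !ltr_norml => /andP[? ?] /andP[? ?] /andP[? ?].
by apply/andP; split; lra.
Qed.

Definition shifted_band (i j : nat) : set (R * R) :=
  aff (- grid i, - grid j) 1 @^-1` (B `&` band c r (3 * rho)).

(** A new point x is within rho of a point b of the added layer, itself within rho
    of some s in S. So x - s lies in the square of half-side 2 rho; after a
    translation by one of the 16 grid vectors, x is within rho of s, that is in
    the old neighbourhood, and still close to the boundary of the square. *)
Lemma fill_cover : nbhd_in q rho fill `\` B `<=`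
  \big[setU/set0]_(i < 4) \big[setU/set0]_(j < 4) shifted_band i j.
Proof.
move=> x [/nbhd_inE[qx [y [qy [Sy|cy]] xy]] nB].
  by exfalso; apply: nB; apply/nbhd_inE; split; [exact: qO|exists y].
have [b [[[qb Bb] nb] bx]] : exists b, (q `&` B `\` square c (r - rho)) b /\ eucl_dist
    b x < rho.
  have : nbhs y ((fun z => eucl_dist z x) @^-1` [set t | t < rho]).
    apply: open_nbhs_nbhs; split; last by rewrite /= eucl_distC.
    by apply: open_comp => [z _|]; [exact: continuous_eucl_dist|exact: open_lt].
  by move=> /cy[b [Gb bx]]; exists b.
have /nbhd_inE[Ob [s Ss bs]] := Bb.
have b1 := le_lt_trans (eucl_dist_fst b x) bx; have b2 :=
    le_lt_trans (eucl_dist_snd b x) bx.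
have s1 := le_lt_trans (eucl_dist_fst b s) bs; have s2 :=
    le_lt_trans (eucl_dist_snd b s) bs.
have xs1 : `|x.1 - s.1| < 2 * rho.
  by move: b1 s1; rewrite !ltr_norml => /andP[? ?] /andP[? ?]; apply/andP; split; lra.
have xs2 : `|x.2 - s.2| < 2 * rho.
  by move: b2 s2; rewrite !ltr_norml => /andP[? ?] /andP[? ?]; apply/andP; split; lra.
have [i i4 hi] := grid_net xs1; have [j j4 hj] := grid_net xs2.
rewrite -(bigcup_mkord 4 (fun i => \big[setU/set0]_(j < 4) shifted_band i j));
    exists i => //.
rewrite -(bigcup_mkord 4 (shifted_band i)); exists j => //.
pose z := aff (- grid i, - grid j) 1 x.
have ez1 : z.1 = x.1 - grid i by rewrite /z/= mul1r addrC.
have ez2 : z.2 = x.2 - grid j by rewrite /z/= mul1r addrC.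
have zs1 : `|z.1 - s.1| <= rho / 2 by rewrite ez1 addrAC.
have zs2 : `|z.2 - s.2| <= rho / 2 by rewrite ez2 addrAC.
have zs : eucl_dist z s < rho.
  rewrite -[ltRHS]ger0_norm ?ltW// -sqrtr_sqr ltr_sqrt ?exprn_gt0//.
  rewrite -[(z.1 - s.1) ^+ 2]real_normK ?num_real// -[(z.2 - s.2) ^+ 2]real_normK
      ?num_real//.
  have n1 : `|z.1 - s.1| ^+ 2 <= (rho / 2) ^+ 2
      by rewrite ler_pXn2r ?nnegrE// divr_ge0// ltW.
  have n2 : `|z.2 - s.2| ^+ 2 <= (rho / 2) ^+ 2
      by rewrite ler_pXn2r ?nnegrE// divr_ge0// ltW.
  have := exprn_gt0 2 rho0; rewrite expr_div_n in n1 n2; lra.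
have /in_square[q1 q2] := qb.
have zq : square c (r + 2 * rho) z by apply/in_square; split;
    [exact: near_band_le s1 zs1 q1|exact: near_band_le s2 zs2 q2].
rewrite /shifted_band /preimage/= -/z; split.
  by apply/nbhd_inE; split; [exact: sqO|exists s].
split; first by apply: square_subset zq; rewrite lerD2l ler_pM2r// ler_nat.
move=> /in_square[z1 z2]; apply: nb; apply/in_square.
by split; [exact: near_band_ge s1 zs1 z1|exact: near_band_ge s2 zs2 z2].
Qed.

Lemma leb2_fill : (leb2 (nbhd_in q rho fill `\` B) <= 16%:E * leb2 (B `&` band c r (3 *
    rho)))%E.
Proof.
have mB : measurable (B : set (mR * mR)).
  by apply: open_measurable2; exact: open_nbhd_in.
have mT : measurable (B `&` band c r (3 * rho) : set (mR * mR)).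
  by apply: measurableI => //; exact: measurable_band.
pose F i j : set (mR * mR) := shifted_band i j.
have mF i j : measurable (F i j) by exact: measurable_preimage_aff.
have lF i j : (leb2 (F i j) <= leb2 (B `&` band c r (3 * rho)))%E.
  by rewrite [leRHS](leb2_aff (- grid i, - grid j) ltr01 mT) expr1n mul1e.
have mFi i : measurable (\big[setU/set0]_(j < 4) F i j) by exact: bigsetU_measurable.
apply: (@le_trans _ _ (leb2 (\big[setU/set0]_(i < 4) \big[setU/set0]_(j < 4) F i j))).
  apply: le_measure; rewrite ?inE.
  - by apply: measurableD => //; apply: open_measurable2; apply: open_nbhd_in;
      exact: open_square.
  - exact: bigsetU_measurable.
  - exact: fill_cover.
apply: (le_trans (@Boole_inequality _ _ _ (leb2 : {measure set (mR * mR) ->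
    \bar R}) _ 4 (fun i _ => mFi i))).
apply: (@le_trans _ _ (\sum_(i < 4) \sum_(j < 4) leb2 (B `&` band c r (3 * rho)))%E).
  apply: lee_sum => i _.
  apply: (le_trans (@Boole_inequality _ _ _ (leb2 : {measure set (mR * mR) ->
      \bar R}) _ 4 (fun j _ => mF i j))).
  by apply: lee_sum => j _; exact: lF.
have m0 : (0 <= leb2 (B `&` band c r (3 * rho)))%E by exact: measure_ge0.
move: (leb2 (B `&` band c r (3 * rho))) m0 => m m0; rewrite !big_const_ord /=.
case: m m0 => [t _|_|//]; last by rewrite gt0_muley ?leey// lte_fin.
by rewrite -EFinM lee_fin; lra.
Qed.

End fill.
End localization.

(** * Lower bound on one square *)

Section squares.
Context {R : realType}.
Notation mR := (measurableTypeR R).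
Implicit Types (A : R * R -> 'M[R]_2) (S Om : set (R * R)) (c : R * R).

Section one_square.
Variables (lam eps : R) (Om S : set (R * R)) (c : R * R) (r : R) (A : R * R -> 'M[R]_2).
Local Notation rho := (lam * eps).
Hypotheses (rho0 : 0 < rho) (oOm : open Om) (sqO : square c (r + 2 * rho) `<=` Om).
Hypothesis LA : L1_field Om A.
Local Notation q := (square c r).
Local Notation B := (nbhd_in Om rho S).
Local Notation B' := (nbhd_in q rho (fill lam eps Om S c r)).
Local Notation T := (band c r (3 * rho)).

Lemma square_sub_domain : q `<=` Om.
Proof. by apply: subset_trans sqO; apply: square_subset;
    rewrite lerDl mulr_ge0// ltW. Qed.

Let mB : measurable (B : set (mR * mR)).
Proof. by apply: open_measurable2; exact: open_nbhd_in. Qed.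

Let mB' : measurable (B' : set (mR * mR)).
Proof. by apply: open_measurable2; apply: open_nbhd_in; exact: open_square. Qed.

Let mT : measurable (T : set (mR * mR)).
Proof. exact: measurable_band. Qed.

Let leb2U_le (X Y Z : set (mR * mR)) : measurable X -> measurable Y -> measurable Z ->
  Z `<=` X `|` Y -> (leb2 Z <= leb2 X + leb2 Y)%E.
Proof.
move=> mX mY mZ ZXY.
apply: (@le_trans _ _ (leb2 (X `|` Y))).
  by apply: le_measure; rewrite ?inE//; exact: measurableU.
exact: (measureU2 (leb2 : {measure set (mR * mR) -> \bar R})).
Qed.

Lemma leb2_nbhd_fill : (leb2 B' <= leb2 B + 16%:E * leb2 (B `&` T))%E.
Proof.
apply: (@le_trans _ _ (leb2 B + leb2 (B' `\` B))%E).
  apply: leb2U_le => //; first exact: measurableD.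
  by move=> x B'x; have [Bx|nBx] := pselect (B x); [left|right].
by apply: leeD2l; exact: leb2_fill.
Qed.

(** Enlarging the neighbourhood only lowers the elastic part; the new area is that
    of [leb2_fill]. *)
Lemma energy_fill : (energy lam eps q A (fill lam eps Om S c r) q <=
  energy lam eps Om A S q + 16%:E * leb2 (B `&` T))%E.
Proof.
have mq : measurable (q : set (mR * mR)) by exact: measurable_square.
have key (u v w s t : \bar R) : (u <= w -> v <= s + t -> u + v <= w + s + t)%E.
  by move=> uw vst; rewrite -addeA; exact: leeD.
apply: key.
  apply: (ge0_subset_integral leb2 (measurableD mq mB') (measurableD mq mB)).
  - apply: (measurable_energy_density oOm LA); last exact: measurableD.
    by move=> x [/square_sub_domain].
  - by move=> x _; rewrite lee_fin sqr_ge0.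
  - move=> x [qx nB']; split=> // Bx; apply: nB'.
    by apply: (nbhd_in_fill rho0); split.
apply: (@le_trans _ _ (leb2 (B `&` q) + leb2 (B' `\` B))%E).
  apply: leb2U_le.
  - exact: measurableI.
  - exact: measurableD.
  - exact: measurableI.
  - by move=> x [B'x qx]; have [Bx|nBx] := pselect (B x); [left|right].
by apply: leeD2l; exact: leb2_fill.
Qed.

End one_square.

(** The bound on the unit square, transported to the square of half-side r by the
    dilation of ratio 2 r. The centre lies on the axis, so the dilation fixes the
    interface field. *)
Lemma square_lower_bound (lam tau : R) (Rm Rp : 'M[R]_2) (C eta : R) :
  SO2 Rm -> SO2 Rp ->
  (forall e A S, 0 < e < eta -> admissible tau e (Q 2^-1) A S ->
    (L1dist lam e (Q 2^-1) A S Rm Rp < eta%:E)%E ->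
    (C%:E < (e^-1)%:E * energy lam e (Q 2^-1) A S (Q 2^-1))%E) ->
  forall (eps r : R) (c : R * R) A S, 0 < eps -> 0 < lam -> 0 < r -> c.1 = 0 ->
  square c (r + 2 * (lam * eps)) `<=` Q 2^-1 ->
  admissible tau eps (Q 2^-1) A S -> eps / (2 * r) < eta ->
  let B := nbhd_in (Q 2^-1) (lam * eps) S in
  let T := band c r (3 * (lam * eps)) in
  (L1dist lam eps (Q 2^-1) A S Rm Rp + (Num.sqrt 2)%:E * (leb2 B + 16%:E * leb2 (B `&` T))
     < ((2 * r) ^+ 2 * eta)%:E)%E ->
  ((C * (2 * r) * eps)%:E <= energy lam eps (Q 2^-1) A S (square c r) +
      16%:E * leb2 (B `&` T))%E.
Proof.
move=> sm sp LB eps r c A S e0 l0 r0 c1 sqO ad er B T L1.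
have rho0 : 0 < lam * eps by exact: mulr_gt0.
set k := 2 * r in er L1 *; have k0 : 0 < k by exact: mulr_gt0.
have k20 : 0 < k ^+ 2 by exact: exprn_gt0.
have oQ : open (Q (2^-1 : R)) by rewrite Q_square; exact: open_square.
have LA : L1_field (Q 2^-1) A by case: ad.
have qO := square_sub_domain rho0 sqO.
set S' := fill lam eps (Q 2^-1) S c r.
have ad' : admissible tau eps (square c r) A S'.
  have rc : relatively_closed (square c r) S' by apply: relatively_closed_fill => //;
      case: ad.
  exact: (admissible_restrict oQ (@open_square R c r) qO ad rc (@subset_fill _ _ _ _ S
      _ _)).
have LA' : L1_field (square c r) A by case: ad'.
have pre : aff c k @^-1` (square c r) = Q 2^-1.
  by rewrite -(preimage_square c k0) /k (mulrC 2 r) mulfK.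
have := admissible_aff c k0 (@open_square R c r) ad'; rewrite pre => ad''.
have L1' := L1dist_aff k0 lam eps S' Rm Rp (@open_square R c r) LA' c1;
    rewrite pre in L1'.
have E' := energy_aff c k0 S' lam eps (@open_square R c r) LA'; rewrite pre in E'.
have ek0 : 0 < eps / k < eta by rewrite divr_gt0.
have BB := @nbhd_in_fill _ lam eps (Q 2^-1) S c r rho0.
have L1lt : (L1dist lam (eps / k) (Q 2^-1) (A \o aff c k)
    (aff c k @^-1` S') Rm Rp < eta%:E)%E.
  rewrite -(@lte_pmul2l _ (k ^+ 2)%:E) ?lte_fin// -L1' -EFinM; apply: le_lt_trans L1.
  apply: (le_trans (L1dist_le oQ (@open_square R c r) qO LA sm sp BB)).
  apply: leeD2l; apply: lee_wpmul2l; first by rewrite lee_fin sqrtr_ge0.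
  exact: leb2_nbhd_fill.
have := LB _ _ _ ek0 ad'' L1lt => CE.
apply: le_trans (energy_fill S rho0 oQ sqO LA).
rewrite E' (_ : C * k * eps = k ^+ 2 * (eps / k) * C); last by field; exact: lt0r_neq0.
rewrite -mulrA EFinM lee_pmul2l ?lte_fin// EFinM.
have ek1 : 0 < eps / k by rewrite divr_gt0.
by rewrite -lee_pdivlMl// ltW.
Qed.

Lemma leb2_pigeonhole (F : nat -> set (mR * mR)) (X : set (mR * mR)) (K : R) (M : nat) :
  (0 < M)%N -> (forall i, measurable (F i)) -> trivIset setT F -> measurable X ->
  (forall i, (i < M)%N -> F i `<=` X) -> (leb2 X <= K%:E)%E ->
  exists2 j, (j < M)%N & (leb2 (F j) <= (K / M%:R)%:E)%E.
Proof.
move=> M0 mF tF mX FX XK; apply: contrapT => nex.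
have gt j : (j < M)%N -> ((K / M%:R)%:E < leb2 (F j))%E.
  by move=> jM; rewrite ltNge; apply/negP => h; apply: nex; exists j.
have fin j : (j < M)%N -> leb2 (F j) = (fine (leb2 (F j)))%:E.
  move=> jM; rewrite fineK// ge0_fin_numE ?measure_ge0//.
  apply: (@le_lt_trans _ _ (leb2 X)); last by rewrite (le_lt_trans XK)// ltry.
  by apply: le_measure; rewrite ?inE//; exact: FX.
have : (leb2 (\big[setU/set0]_(j < M) F j) <= K%:E)%E.
  apply: le_trans XK; apply: le_measure; rewrite ?inE//; first exact: bigsetU_measurable.
  by rewrite -bigcup_mkord => x [j /= jM Fx]; exact: (FX j).
have -> : (leb2 (\big[setU/set0]_(j < M) F j) = \sum_(j < M) leb2 (F j))%E.
  exact: (@measure_bigsetU _ _ _ (leb2 : {measure set (mR * mR) -> \bar R}) F mF tF M).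
rewrite (eq_bigr (fun j : 'I_M => (fine (leb2 (F j)))%:E)); last by move=> j _;
    exact: fin.
rewrite sumEFin lee_fin leNgt => /negP; apply.
have -> : K = \sum_(j < M) K / M%:R.
  by rewrite sumr_const card_ord -[RHS]mulr_natr divfK// pnatr_eq0 -lt0n.
apply: ltr_sum; first by apply/hasP; exists (Ordinal M0) => //; rewrite mem_index_enum.
by move=> j _; rewrite -lte_fin -fin//; exact: gt.
Qed.

End squares.

(** * Each square on the interface carries its share *)

Section radius_arithmetic.
Context {R : realFieldType}.
Implicit Types d e r h rho p s k m : R.

Lemma radius_ge_half d e r : d - e <= r -> e <= d / 2 -> d <= 2 * r.
Proof. by move=> ? ?; lra. Qed.

Lemma radius_add_le d r h rho : r + h <= d -> 6 * rho <= h -> 0 < rho -> r + 2 * rho <= d.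
Proof. by move=> ? ? ?; lra. Qed.

(** The loss in the lower bound when p is replaced by p - s, the half-side d by a
    radius r, and the area m of the bad band is paid for: each of the three costs
    at most k / 4. *)
Lemma radius_error d e r p s k m : 8 * (e * p) <= k -> 8 * (d * s) = k -> 64 * m <= k ->
  0 < k -> (d - e) * p <= r * p -> r * s <= d * s ->
  2 * d * p - k <= (p - s) * (2 * r) - 16 * m.
Proof. by move=> ? ? ? ? ? ?; lra. Qed.

End radius_arithmetic.

Lemma sqrt2_le2 (R : realType) : Num.sqrt 2 <= 2 :> R.
Proof. by rewrite -[leRHS]ger0_norm// -sqrtr_sqr ler_wsqrtr//; lra. Qed.

Section final.
Context {R : realType}.
Notation mR := (measurableTypeR R).
Variables (lambda tau : R).
Hypotheses (lambda_gt0 : 0 < lambda).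
Variables (Rm Rp : 'M[R]_2).
Hypotheses (SO2_Rm : SO2 Rm) (SO2_Rp : SO2 Rp).
Variables (A : R -> R * R -> 'M[R]_2) (S : R -> set (R * R)) (p : R).
Hypotheses (AS_family : interface_family lambda tau Rm Rp A S) (p0 : 0 <= p)
  (psi0p : psi0 lambda tau Rm Rp = p%:E).
Hypothesis AS_optimal : ((eps^-1)%:E *
       energy lambda eps (Q 2^-1) (A eps) (S eps) (Q 2^-1))%E
     @[eps --> 0^'+] --> p%:E.

Local Notation F eps E := (energy lambda eps (Q 2^-1) (A eps) (S eps) E).

Let oQ : open (Q (2^-1 : R)). Proof. by rewrite Q_square; exact: open_square. Qed.

Lemma energy_le_near (k : R) : 0 < k ->
  \forall eps \near 0^'+, ((eps^-1)%:E * F eps (Q 2^-1) <= (p + k)%:E)%E.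
Proof.
move=> k0; have /fine_cvgP[fI /cvgrPdist_le/(_ k k0) kI] := AS_optimal.
near=> e; rewrite -[leLHS]fineK; last by near: e; exact: fI.
rewrite lee_fin -lerBlDl; apply: le_trans (ler_norm _) _; rewrite distrC.
by near: e; exact: kI.
Unshelve. all: by end_near.
Qed.

Lemma L1dist_lt_near (k : R) : 0 < k ->
  \forall eps \near 0^'+, (L1dist lambda eps (Q 2^-1) (A eps) (S eps) Rm Rp < k%:E)%E.
Proof.
move=> k0; have [_ cI] := AS_family.
have k20 : 0 < k / 2 by rewrite divr_gt0.
have /fine_cvgP[fI /cvgrPdist_le/(_ _ k20) kI] := cI.
near=> e; apply: (@le_lt_trans _ _ (k / 2)%:E); last by rewrite lte_fin; lra.
rewrite -[leLHS]fineK; last by near: e; exact: fI.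
rewrite lee_fin; apply: le_trans (ler_norm _) _; rewrite -normrN -[- _]sub0r.
by near: e; exact: kI.
Unshelve. all: by end_near.
Qed.

(** Consecutive radii differ by h, which is at least the width 6 rho of a band. *)
Lemma trivIset_bands (B : set (R * R)) c d h rho : 6 * rho <= h ->
  trivIset [set: nat] (fun j : nat => B `&` band c (d - j.+1%:R * h) (3 * rho)).
Proof.
move=> rh; have h0 : 0 <= rho -> 0 <= h by move=> ?; lra.
have [rho0|rho0] := leP 0 rho; last first.
  move=> i j _ _ [x [[_ [xi nxi]] _]]; exfalso; apply: nxi; apply: square_subset xi; lra.
have main i j x : (i < j)%N -> band c (d - i.+1%:R * h) (3 * rho) x ->
    band c (d - j.+1%:R * h) (3 * rho) x -> False.
  move=> ij [_ nx] [xj _]; apply: nx; apply: square_subset xj.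
  have : i.+2%:R * h <= j.+1%:R * h by rewrite ler_wpM2r ?h0// ler_nat.
  rewrite -[i.+2%:R]natr1 mulrDl; lra.
move=> i j _ _ [x [[_ xi] [_ xj]]].
by case: (ltngtP i j) => // ij; exfalso; [exact: main xi xj|exact: main xj xi].
Qed.

(** Apply [square_lower_bound] on a slightly smaller square, of radius chosen
    depending on eps by the pigeonhole principle so that the neighbourhood of S
    is sparse around its boundary. *)
Lemma square_liminf (d k : R) (c : R * R) : 0 < d -> 0 < k -> c.1 = 0 ->
  square c d `<=` Q 2^-1 ->
  \forall eps \near 0^'+, ((2 * d * p - k)%:E <= (eps^-1)%:E * F eps (square c d))%E.
Proof.
move=> d0 k0 c1 sqQ.
(* s, eta1 and M make each of the three losses of radius_error at most k / 4 *)
pose s := k / (8 * d).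
have s0 : 0 < s by rewrite divr_gt0// mulr_gt0.
have ds : 8 * (d * s) = k by rewrite /s; field; exact: lt0r_neq0.
have /(psi0_lower_bound lambda_gt0 SO2_Rm SO2_Rp)[eta eta0 LB] : ((p - s)%:E < psi0
    lambda tau Rm Rp)%E.
  by rewrite psi0p lte_fin ltrBlDr ltrDl.
pose K := p + 1; have K0 : 0 < K by rewrite /K ltr_wpDl.
pose eta1 := Num.min (d / 2) (k / (8 * K)).
have eta10 : 0 < eta1 by rewrite lt_min !divr_gt0// mulr_gt0.
have eta1d : eta1 <= d / 2 by rewrite ge_min lexx.
have eta1p : 8 * (eta1 * p) <= k.
  have e1 : eta1 <= k / (8 * K) by rewrite ge_min lexx orbT.
  have : eta1 * (8 * K) <= k by rewrite -ler_pdivlMr// mulr_gt0.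
  have : 0 <= eta1 by exact: ltW.
  rewrite /K; nra.
pose M := (Num.Def.archi_bound (64 * K / k)).
have M1 : 64 * K / k < M%:R by apply: archi_boundP; rewrite ltW// divr_gt0// mulr_gt0.
have M0 : (0 < M)%N.
  by rewrite -(ltr_nat R) (lt_trans _ M1)// divr_gt0// mulr_gt0.
have M0' : 0 < M%:R :> R by rewrite ltr0n.
have KM : 64 * (K / M%:R) <= k.
  by rewrite mulrA ler_pdivrMr// [leRHS]mulrC -ler_pdivrMr// ltW.
pose h := eta1 / M%:R.
have h0 : 0 < h by rewrite divr_gt0.
have hM : M%:R * h = eta1 by rewrite /h mulrC divfK// lt0r_neq0.
have d20 : 0 < d ^+ 2 * eta / 2 by rewrite divr_gt0// mulr_gt0// exprn_gt0.
(* 34 K eps = 2 (1 + 16) K eps bounds sqrt 2 times the area of the neighbourhood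
   of the filled set *)
near=> eps.
have e0 : 0 < eps by near: eps; exact: nbhs_right_gt.
have rho0 : 0 < lambda * eps by exact: mulr_gt0.
have rh : 6 * (lambda * eps) <= h.
  rewrite mulrA mulrC -ler_pdivlMr ?mulr_gt0//; apply/ltW.
  by near: eps; apply: nbhs_right_lt; rewrite divr_gt0// mulr_gt0.
have ed : eps / d < eta.
  rewrite ltr_pdivrMr//; near: eps; apply: nbhs_right_lt; exact: mulr_gt0.
have eK : 34 * K * eps < d ^+ 2 * eta / 2.
  rewrite mulrC -ltr_pdivlMr ?mulr_gt0//; near: eps; apply: nbhs_right_lt.
  by rewrite divr_gt0// mulr_gt0.
have L1 : (L1dist lambda eps (Q 2^-1) (A eps) (S eps) Rm Rp < (d ^+ 2 * eta / 2)%:E)%E.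
  by near: eps; exact: L1dist_lt_near.
have EK : ((eps^-1)%:E * F eps (Q 2^-1) <= K%:E)%E by near: eps; exact: energy_le_near.
have ad : admissible tau eps (Q 2^-1) (A eps) (S eps) by case: AS_family => + _; exact.
set B := nbhd_in (Q 2^-1) (lambda * eps) (S eps).
have mB : measurable (B : set (mR * mR)).
  by apply: open_measurable2; exact: open_nbhd_in.
have BK : (leb2 B <= (K * eps)%:E)%E.
  rewrite mulrC EFinM -lee_pdivrMl//; apply: le_trans EK.
  rewrite lee_pmul2l ?lte_fin ?invr_gt0// /energy.
  rewrite (_ : nbhd_in _ _ _ `&` _ = B); last by apply/seteqP; split=> [x []|x Bx]//;
      split=> //; case: Bx.
  by apply: leeDr; apply: integral_ge0 => x _; rewrite lee_fin sqr_ge0.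
pose r j : R := d - j.+1%:R * h.
pose T j : set (mR * mR) := B `&` band c (r j) (3 * (lambda * eps)).
have mT i : measurable (T i) by apply: measurableI => //; exact: measurable_band.
have tT : trivIset setT T by exact: trivIset_bands.
have TB i : (i < M)%N -> T i `<=` B by move=> _ x [].
have [j jM Tj] := leb2_pigeonhole M0 mT tT mB TB BK.
have jh : 0 < j.+1%:R * h <= eta1.
  rewrite mulr_gt0//= -hM; apply: ler_wpM2r; [exact: ltW|by rewrite ler_nat].
have [rj1 rj2] : d - eta1 <= r j /\ r j + h <= d.
  have hj : h <= j.+1%:R * h by rewrite -[leLHS]mul1r; apply: ler_wpM2r;
      [exact: ltW|rewrite ler1n].
  have /andP[_ jh2] := jh.
  by split; [rewrite lerD2l lerN2|rewrite -addrA gerDl addrC subr_le0].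
have rj_half := radius_ge_half rj1 eta1d.
have rj0 : 0 < r j by rewrite -(pmulr_rgt0 _ (@ltr0n R 2)) (lt_le_trans d0).
have rjd : r j <= d by apply: le_trans rj2; rewrite lerDl ltW.
have TjB : (leb2 (T j) <= leb2 B)%E by apply: le_measure; rewrite ?inE//; exact: TB.
have sqr : square c (r j + 2 * (lambda * eps)) `<=` Q 2^-1.
  by apply: subset_trans sqQ; apply: square_subset; exact: radius_add_le rj2 rh rho0.
have er : eps / (2 * r j) < eta.
  by apply: le_lt_trans ed; rewrite ler_pM2l// lef_pV2 ?posrE ?mulr_gt0.
have H := square_lower_bound SO2_Rm SO2_Rp LB e0 lambda_gt0 rj0 c1 sqr ad er.
have {}H : (((p - s) * (2 * r j) * eps)%:E <= F eps (square c (r j)) +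
    16%:E * leb2 (T j))%E.
  apply: H; apply: (@le_lt_trans _ _ (L1dist lambda eps (Q 2^-1) (A eps)
      (S eps) Rm Rp + (34 * K * eps)%:E)%E).
    apply: leeD2l; rewrite (_ : 34 * K * eps = 2 * (K * eps + 16 * (K * eps)));
        last by ring.
    rewrite EFinM; apply: lee_pmul.
    - by rewrite lee_fin sqrtr_ge0.
    - by rewrite adde_ge0// mule_ge0.
    - by rewrite lee_fin sqrt2_le2.
    - rewrite (EFinD (K * eps)); apply: leeD => //; rewrite (EFinM 16);
        apply: lee_wpmul2l => //.
      exact: le_trans TjB BK.
  apply: (@lt_le_trans _ _ ((d ^+ 2 * eta / 2)%:E + (d ^+ 2 * eta / 2)%:E)%E).
    by apply: lteD; rewrite ?lte_fin.
  rewrite -EFinD lee_fin -splitr; apply: ler_wpM2r; first exact: ltW.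
  rewrite ler_pXn2r ?nnegrE//; first exact: ltW.
  by apply: mulr_ge0 => //; exact: ltW.
have {}H : (((p - s) * (2 * r j) * eps - 16 * (K * eps / M%:R))%:E <= F eps (square c
    d))%E.
  rewrite EFinB leeBlDr//; apply: (le_trans H); apply: leeD.
    apply: (energyS _ _ _ oQ) => //.
    - by case: ad.
    - exact: square_subset.
    - exact: measurable_square.
    - exact: measurable_square.
  by rewrite EFinM; apply: lee_wpmul2l.
rewrite lee_pdivlMl//; apply: le_trans H; rewrite -EFinM lee_fin.
rewrite [leRHS](_ : _ = eps * ((p - s) * (2 * r j) - 16 * (K / M%:R))); last by ring.
rewrite ler_pM2l//.
have : (d - eta1) * p <= r j * p by rewrite ler_wpM2r.
have : r j * s <= d * s by apply: ler_wpM2r => //; exact: ltW.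
move=> rs rp; exact: radius_error eta1p ds KM k0 rp rs.
Unshelve. all: by end_near.
Qed.

End final.

(** * Stacking squares in the strip *)

Section stack.
Context {R : realType}.
Notation mR := (measurableTypeR R).

Lemma energy_bigsetU (lam eps : R) (Om S : set (R * R)) (A : R * R -> 'M[R]_2)
    (F : nat -> set (R * R)) n : open Om -> L1_field Om A ->
  (forall k, measurable (F k : set (mR * mR))) -> trivIset setT F ->
  (forall k, (k < n)%N -> F k `<=` Om) ->
  energy lam eps Om A S (\big[setU/set0]_(k < n) F k) = (\sum_(k < n) energy lam eps Om
      A S (F k))%E.
Proof.
move=> oOm LA mF tF; elim: n => [|n IH] FO.
  rewrite !big_ord0 /energy set0D integral_set0 setI0 add0e.
  exact: (measure0 (leb2 : {measure set (mR * mR) -> \bar R})).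
rewrite !big_ord_recr/= energyU//.
- by rewrite IH// => k kn; apply: FO; exact: ltnW.
- by rewrite -bigcup_mkord => x [k /= kn]; apply: FO; exact: ltnW.
- exact: FO.
- exact: bigsetU_measurable.
- rewrite -bigcup_mkord setI_bigcupl; apply/seteqP; split=> // x [k /= kn Fx].
  by have := tF k n I I (ex_intro _ x Fx); move: kn => /[swap] ->; rewrite ltnn.
Qed.

Definition stack_center (d : R) (k : nat) : R * R := (0, - 2^-1 + d * (2 * k%:R + 1)).

Lemma trivIset_stack (d : R) : 0 < d -> trivIset setT (fun k =>
    square (stack_center d k) d).
Proof.
move=> d0.
have main i j x : (i < j)%N -> square (stack_center d i) d x ->
    square (stack_center d j) d x -> False.
  rewrite /square/= => ij [_ /andP[_ h1]] [_ /andP[h2 _]].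
  have : d * i.+1%:R <= d * j%:R by rewrite ler_pM2l// ler_nat.
  by rewrite -natr1 mulrDr; lra.
move=> i j _ _ [x [xi xj]].
by case: (ltngtP i j) => // ij; exfalso; [exact: main xi xj|exact: main xj xi].
Qed.

Lemma stack_sub_strip (d delta : R) (N k : nat) : 0 < d -> d <= delta ->
  2 * d * N%:R = 1 -> (k < N)%N -> square (stack_center d k) d `<=` rect delta 2^-1.
Proof.
move=> d0 dd dN kN x [/andP[/= x1 x2] /andP[/= x3 x4]].
have : d * k.+1%:R <= d * N%:R by rewrite ler_pM2l// ler_nat.
have : 0 <= d * k%:R by rewrite mulr_ge0// ltW.
rewrite -natr1 mulrDr mulr1 => dk0 dk1.
by split; apply/andP; split; lra.
Qed.

End stack.

Theorem proposition6p1 (R : realType) (lambda tau : R)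
  (lambda_gt0 : 0 < lambda) (tau_gt0 : 0 < tau)
  (Rm Rp : 'M[R]_2) (SO2_Rm : SO2 Rm) (SO2_Rp : SO2 Rp)
  (A : R -> R * R -> 'M[R]_2) (S : R -> set (R * R))
  (AS_family : interface_family lambda tau Rm Rp A S)
  (AS_optimal : ((eps^-1)%:E *
       energy lambda eps (Q 2^-1) (A eps) (S eps) (Q 2^-1))%E
     @[eps --> 0^'+] --> psi0 lambda tau Rm Rp)
  (delta : R) (delta_gt0 : 0 < delta) (delta_lt : delta < 4^-1) :
  ((eps^-1)%:E * energy lambda eps (Q 2^-1) (A eps) (S eps)
       (Q 2^-1 `\` rect delta 2^-1))%E
    @[eps --> 0^'+] --> 0%E.
Proof.
have [p [p0 psi0p]] := psi0_fin tau lambda_gt0 SO2_Rm SO2_Rp.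
rewrite psi0p in AS_optimal.
have oQ : open (Q (2^-1 : R)) by rewrite Q_square; exact: open_square.
(* N squares of side 2 d = 1 / N fill the height of the strip, and d <= delta *)
pose N := (Num.Def.archi_bound (delta^-1)).
have Nd : delta^-1 < N%:R by apply: archi_boundP; rewrite invr_ge0 ltW.
have N0 : 0 < N%:R :> R by rewrite (lt_trans _ Nd)// invr_gt0.
pose d : R := (2 * N%:R)^-1.
have d0 : 0 < d by rewrite invr_gt0 mulr_gt0.
have dN : 2 * d * N%:R = 1 by rewrite /d; field; exact: lt0r_neq0.
have dd : d <= delta.
  rewrite /d -[leRHS]invrK lef_pV2 ?posrE ?invr_gt0 ?mulr_gt0//.
  by apply: (le_trans (ltW Nd)); apply: ler_peMl; [exact: ltW|rewrite ler1n].
have stripQ : rect delta 2^-1 `<=` Q 2^-1.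
  move=> x [/andP[x1 x2] x34]; split=> //; apply/andP; split; lra.
have mstrip : measurable (rect delta 2^-1 : set (measurableTypeR R * measurableTypeR R)).
  by rewrite rect_itv; exact: measurableX.
have mQ : measurable (Q 2^-1 : set (measurableTypeR R * measurableTypeR R)).
  exact: open_measurable2.
pose q k := square (stack_center d k) d.
have q_strip k : (k < N)%N -> q k `<=` rect delta 2^-1.
  exact: stack_sub_strip.
have q_Q k : (k < N)%N -> q k `<=` Q 2^-1.
  by move=> kN; apply: subset_trans stripQ; exact: q_strip.
apply: cvge0_le => k k0.
have k20 : 0 < k / 2 by rewrite divr_gt0.
have kN0 : 0 < k / 2 / N%:R by rewrite divr_gt0.
pose F eps E := energy lambda eps (Q 2^-1) (A eps) (S eps) E.
near=> eps.
have e0 : 0 < eps by near: eps; exact: nbhs_right_gt.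
have e10 : (0 < (eps^-1)%:E)%E by rewrite lte_fin invr_gt0.
have [LA _ _ _] : admissible tau eps (Q 2^-1) (A eps) (S eps) by have [ad _] :=
    AS_family; exact: ad.
have F0 E : (0 <= F eps E)%E by exact: energy_ge0.
have eF0 E : (0 <= (eps^-1)%:E * F eps E)%E by apply: mule_ge0 => //; exact: ltW.
have total : ((eps^-1)%:E * F eps (Q 2^-1) <= (p + k / 2)%:E)%E.
  by near: eps; exact: (energy_le_near AS_optimal k20).
have each (i : 'I_N) : ((2 * d * p - k / 2 / N%:R)%:E <= (eps^-1)%:E * F eps (q i))%E.
  move: i; near: eps; apply: filter_forall => i.
  apply: (square_liminf lambda_gt0 SO2_Rm SO2_Rp AS_family p0 psi0p AS_optimal d0 kN0)
      => //.
  exact: q_Q.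
have strip : ((p - k / 2)%:E <= (eps^-1)%:E * F eps (rect delta 2^-1))%E.
  apply: (@le_trans _ _ ((eps^-1)%:E * \sum_(i < N) F eps (q i))%E).
    rewrite ge0_sume_distrr//.
    apply: (@le_trans _ _ (\sum_(i < N) (2 * d * p - k / 2 / N%:R)%:E)%E);
        last exact: lee_sum.
    rewrite sumEFin lee_fin sumr_const card_ord -[leRHS]mulr_natr mulrBl divfK
        ?lt0r_neq0//.
    by rewrite mulrAC dN mul1r.
  rewrite lee_pmul2l//.
  have <- := @energy_bigsetU _ lambda eps _ (S eps) _ q N oQ LA (fun k =>
      @measurable_square _ _ _) (trivIset_stack d0) q_Q.
  apply: energyS => //.
  - by rewrite -bigcup_mkord => x [i /= iN]; exact: q_strip.
  - by apply: bigsetU_measurable => i _; exact: measurable_square.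
have split_energy : F eps (Q 2^-1) = (F eps (rect delta 2^-1) +
    F eps (Q 2^-1 `\` rect delta 2^-1))%E.
  rewrite -energyU ?setDUK//.
  - exact: measurableD.
  - by apply/seteqP; split=> // x [? []].
apply/andP; split; first exact: eF0.
have key (x y : \bar R) : (0 <= x -> 0 <= y -> x + y <= (p + k / 2)%:E ->
    (p - k / 2)%:E <= x -> y <= k%:E)%E.
  by case: x y => [x| |] [y| |]//=; rewrite -?EFinD ?lee_fin => *; lra.
apply: key (eF0 _) (eF0 _) _ strip.
by rewrite -ge0_muleDr// -split_energy.
Unshelve. all: by end_near.
Qed.
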